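(* Let $0<c\le\infty$ and let $f\in C((-c,c),\mathbb R)$ satisfy: ($f_1$) $f$ is odd, $f(0)=0$, and there exist $0<b<\beta<c$ such that $f(s)>0$ for $s>b$, $f(s)\le 0$ and $f(s)\not\equiv 0$ for $s\in[0,b]$, and $F(\beta)=0$, where $F(s):=\int_0^s f(t)\,dt$; ($f_2$) $f$ is continuously differentiable in $(0,c)$ and $f'\in L^1(0,1)$. Let $q$ satisfy: ($q_1$) $q\in C^1(\mathbb R^+;\mathbb R^+)$, $q\ge 0$, $q(0)=0$ and $q'>0$ on $(0,\infty)$; ($q_2$) $q'/q$ is strictly decreasing on $(0,\infty)$. Let $Q(r):=\int_0^r q(s)\,ds$, and assume in addition: ($q_3$) (i) the function $H(r):=\left(\frac{Q}{q}\right)'(r)$ is nonincreasing in $(0,\infty)$, with $H(0)<\frac12$ and $H_\infty:=\lim_{r\to\infty}H(r)>0$, and (ii) $q(r)(H(r)-H_\infty)$ is nondecreasing in $(0,\infty)$; ($f_3$) $\left(\frac{F}{f}\right)'(s)\ge\frac12(1-2H_\infty)$ for all $s>\beta$. Then the problem $$(q\,u')'+q(r)f(u)=0,\quad r>0,\qquad u'(0)=0,\qquad \lim_{r\to+\infty}u(r)=0,$$ has at most one nonnegative solution satisfying $u(0)>0$.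
   Context: $'$ denotes $\frac{d}{dr}$ for functions of $r$ (and $\frac{d}{ds}$ for functions of $s$). $\mathbb R^+=[0,\infty)$. Conditions on $f$ for large $s$ (such as $s>b$ or $s>\beta$) are understood for $s<c$. $H(0)$ is the limit of $H(r)$ as $r\to0^+$. A solution $u=u(r)$, $r\ge0$, is a classical solution with values in $(-c,c)$. *)

(* Defs.v *)
(* Calculus is Coquelicot's, on Stdlib's R; MathComp-Analysis is used only for the
   Lebesgue integrability in [L1_on], through the realType structure of R. *)
From mathcomp Require Import ssreflect ssrbool reals constructive_ereal
  lebesgue_measure lebesgue_integral Rstruct.
From Stdlib Require Import Reals.
From Coquelicot Require Import Coquelicot.

Local Open Scope R_scope.

Definition L1_on (D : R -> Prop) (g : R -> R) : Prop :=
  integrable (lebesgue_measure (R := R)) D (fun x => EFin (g x)).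

Definition primitive (g : R -> R) (x : R) : R := RInt g 0 x.

Definition Rplus_half (r : R) : Prop := 0 <= r.

(* The derivative relative to [0, +oo): two-sided at r > 0, one-sided at r = 0. *)
Definition is_derive_half (g : R -> R) (r l : R) : Prop :=
  filterlim (fun y => (g y - g r) / (y - r))
    (within Rplus_half (locally' r)) (locally l).

Definition C1_half (g dg : R -> R) : Prop :=
  (forall r, 0 <= r -> is_derive_half g r (dg r)) /\ continuous_on Rplus_half dg.

Record cond_f1 (c : Rbar) (f : R -> R) (b beta : R) : Prop := {
  f1_odd : forall s, Rbar_lt (Rabs s) c -> f (- s) = - f s;
  f1_zero : f 0 = 0;
  f1_b_pos : 0 < b;
  f1_b_beta : b < beta;
  f1_beta_c : Rbar_lt beta c;
  f1_pos : forall s, b < s -> Rbar_lt s c -> 0 < f s;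
  f1_nonpos : forall s, 0 <= s <= b -> f s <= 0;
  f1_nontrivial : exists s, 0 <= s <= b /\ f s <> 0;
  f1_F_beta : primitive f beta = 0 }.

(* The interval (0, 1) is cut at c, beyond which f is not defined. *)
Record cond_f2 (c : Rbar) (f : R -> R) : Prop := {
  f2_derivable : forall s, 0 < s -> Rbar_lt s c -> ex_derive f s;
  f2_continuous : forall s, 0 < s -> Rbar_lt s c -> continuous (Derive f) s;
  f2_L1 : L1_on (fun s => 0 < s /\ s < 1 /\ Rbar_lt s c) (Derive f) }.

Definition cond_f3 (c : Rbar) (f : R -> R) (beta Hinf : R) : Prop :=
  forall s, beta < s -> Rbar_lt s c ->
    Derive (fun t => primitive f t / f t) s >= / 2 * (1 - 2 * Hinf).

Record cond_q1 (q : R -> R) : Prop := {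
  q1_C1 : exists dq, C1_half q dq;
  q1_nonneg : forall r, 0 <= r -> 0 <= q r;
  q1_zero : q 0 = 0;
  q1_incr : forall r, 0 < r -> 0 < Derive q r }.

Definition cond_q2 (q : R -> R) : Prop :=
  forall r1 r2, 0 < r1 -> r1 < r2 -> Derive q r2 / q r2 < Derive q r1 / q r1.

Definition H (q : R -> R) (r : R) : R := Derive (fun t => primitive q t / q t) r.

Record cond_q3 (q : R -> R) (H0 Hinf : R) : Prop := {
  q3_H_nonincr : forall r1 r2, 0 < r1 -> r1 <= r2 -> H q r2 <= H q r1;
  q3_H0_lim : filterlim (H q) (at_right 0) (locally H0);
  q3_H0 : H0 < / 2;
  q3_Hinf_lim : is_lim (H q) p_infty Hinf;
  q3_Hinf : 0 < Hinf;
  q3_nondecr : forall r1 r2, 0 < r1 -> r1 <= r2 ->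
    q r1 * (H q r1 - Hinf) <= q r2 * (H q r2 - Hinf) }.

(* Only the restriction of u to [0, +oo) matters; du is u' there. *)
Definition is_solution (c : Rbar) (f q u : R -> R) : Prop :=
  (forall r, 0 <= r -> Rbar_lt (Rabs (u r)) c) /\
  (exists du : R -> R,
     C1_half u du /\
     (forall r, 0 < r ->
        ex_derive (fun x => q x * du x) r /\
        Derive (fun x => q x * du x) r + q r * f (u r) = 0) /\
     du 0 = 0) /\
  is_lim u p_infty 0.

(* Main.v *)
Require Import Defs.
From Stdlib Require Import Reals Lra ClassicalEpsilon.
From Coquelicot Require Import Coquelicot.
Local Open Scope R_scope.

(** Write E = u'^2 / 2 + F(u). Along a solution E' = - (q'/q) u'^2 <= 0, and F(u) tends to 0,
    so E >= 0, with E > 0 as long as u > 0 ([energy_pos]). Hence F(u) > 0 at a critical point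
    with u > 0, so u > beta and f(u) > 0 there, and the sign of (q u')' = - q f(u) rules
    such a point out ([du_neg]). So u decreases strictly until it vanishes for good. Let r be its
    inverse function and p(s) = - u'(r(s)), for s between 0 and the height u(0); then
    r' = - 1 / p and p' = (q'/q)(r) - f / p ([ground_state_profile]). Two solutions of
    equal height coincide by a Gronwall estimate for (u - v)^2 + (u' - v')^2
    ([equal_height_unique]). It remains to refute two heights alpha1 < alpha2.

    Near alpha1 one has r1 < r2 and p1 < p2. As q'/q decreases, p1 < p2 persists towards smaller
    s as long as r1 <= r2 ([slopes_ordered]). If r1 < r2 held throughout, p2 - p1 would not
    decrease as s falls from b to 0, whereas p2 comes arbitrarily close to 0 there. So the graphs
    cross at some sI ([solutions_cross]), where p1 < p2.

    The core of the proof is that p1 < p2 persists on all of (0, sI), so that r2 < r1 there. Put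
    K = (Q/q)', so that (Q/q) (q'/q) = 1 - K. Four functions of s are compared:
    - the flux m = q p, with m' = - q f / p;
    - the Pohozaev function P = 2 Q E - 2 m F/f, with P' = m (1 - 2 K - 2 (F/f)'); by the
      hypotheses on f and q it is nonincreasing above beta, hence nonnegative there, because it
      tends to 0 at the height;
    - Y = (Q/q) E / p, with Y' = 1/2 - K + (Y f - F) / p^2, where Y f >= F amounts to P >= 0;
    - the scaled speed S = (Q/q) sqrt (p^2 + 2 F), with S' = (1 - K) t - K / t and
      t = p / sqrt (p^2 + 2 F).
    In Y' and S' the weight enters only through K. Above beta, either m1 <= m2 or there is s0
    with m1 = m2 at s0 and m1 <= m2 on (s0, alpha1); then P1 <= P2 at s0, which means Y1 <= Y2 at
    s0, and the equation for Y carries this down ([compare_above]). Either alternative gives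
    S1 <= S2 at beta, and the equation for S carries this down to 0, since t decreases in p where
    F <= 0 ([compare_below]). Each of these orderings is incompatible with p1 = p2 and
    r2 < r1, so p1 < p2 cannot be lost ([slopes_ordered_after]). Finally S1 < S2 somewhere, the
    gap S2 - S1 does not shrink as s tends to 0, and S2 comes arbitrarily close to 0 there: a
    contradiction ([crossing_impossible]). *)

(** * Monotonicity, sign changes and differential inequalities *)

Lemma nondecr_of_derive (g dg : R -> R) (x y : R) :
  x <= y ->
  (forall z, x <= z <= y -> is_derive g z (dg z)) ->
  (forall z, x < z < y -> 0 <= dg z) ->
  g x <= g y.
Proof.
intros Hxy Hd Hpos.
destruct (Req_dec x y) as [<- | Hne]; [lra|].
destruct (MVT_cor2 g dg x y) as [z [Hz Hzi]]; [lra| |].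
- intros z Hz; apply is_derive_Reals, Hd; lra.
- assert (0 <= dg z * (y - x)) by (apply Rmult_le_pos; [apply Hpos|]; lra).
  lra.
Qed.

Lemma incr_of_derive (g dg : R -> R) (x y : R) :
  x < y ->
  (forall z, x <= z <= y -> is_derive g z (dg z)) ->
  (forall z, x < z < y -> 0 < dg z) ->
  g x < g y.
Proof.
intros Hxy Hd Hpos.
destruct (MVT_cor2 g dg x y) as [z [Hz Hzi]]; [lra| |].
- intros z Hz; apply is_derive_Reals, Hd; lra.
- assert (0 < dg z * (y - x)) by (apply Rmult_lt_0_compat; [apply Hpos|]; lra).
  lra.
Qed.

Lemma is_derive_opp_R (g : R -> R) (x l : R) :
  is_derive g x l -> is_derive (fun t => - g t) x (- l).
Proof. exact (is_derive_opp g x l). Qed.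

Lemma nonincr_of_derive (g dg : R -> R) (x y : R) :
  x <= y ->
  (forall z, x <= z <= y -> is_derive g z (dg z)) ->
  (forall z, x < z < y -> dg z <= 0) ->
  g y <= g x.
Proof.
intros Hxy Hd Hneg.
enough (- g x <= - g y) by lra.
apply (nondecr_of_derive (fun t => - g t) (fun t => - dg t)); auto.
- intros z Hz; apply is_derive_opp_R; auto.
- intros z Hz; specialize (Hneg z Hz); lra.
Qed.

Lemma decr_of_derive (g dg : R -> R) (x y : R) :
  x < y ->
  (forall z, x <= z <= y -> is_derive g z (dg z)) ->
  (forall z, x < z < y -> dg z < 0) ->
  g y < g x.
Proof.
intros Hxy Hd Hneg.
enough (- g x < - g y) by lra.
apply (incr_of_derive (fun t => - g t) (fun t => - dg t)); auto.
- intros z Hz; apply is_derive_opp_R; auto.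
- intros z Hz; specialize (Hneg z Hz); lra.
Qed.

Lemma is_derive_eq (g : R -> R) (x l l' : R) : is_derive g x l' -> l' = l -> is_derive g x l.
Proof. intros Hg <-; exact Hg. Qed.

Lemma is_derive_plus_R (g h : R -> R) (x l m : R) :
  is_derive g x l -> is_derive h x m -> is_derive (fun t => g t + h t) x (l + m).
Proof. exact (is_derive_plus g h x l m). Qed.

Lemma is_derive_minus_R (g h : R -> R) (x l m : R) :
  is_derive g x l -> is_derive h x m -> is_derive (fun t => g t - h t) x (l - m).
Proof. exact (is_derive_minus g h x l m). Qed.

Lemma is_derive_const_R (k x : R) : is_derive (fun _ : R => k) x 0.
Proof. exact (is_derive_const k x). Qed.

Lemma is_derive_id_R (x : R) : is_derive (fun t : R => t) x 1.
Proof. exact (is_derive_id x). Qed.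

Lemma is_derive_mult_R (g h : R -> R) (x l m : R) :
  is_derive g x l -> is_derive h x m ->
  is_derive (fun t => g t * h t) x (l * h x + g x * m).
Proof. intros Hg Hh; apply (is_derive_mult g h x l m Hg Hh); intros; apply Rmult_comm. Qed.

Lemma is_derive_pow_R (g : R -> R) (n : nat) (x l : R) :
  is_derive g x l -> is_derive (fun t => g t ^ n) x (INR n * l * g x ^ pred n).
Proof. exact (is_derive_pow g n x l). Qed.

Lemma is_derive_comp_R (g h : R -> R) (x l m : R) :
  is_derive g (h x) l -> is_derive h x m -> is_derive (fun t => g (h t)) x (m * l).
Proof. exact (is_derive_comp g h x l m). Qed.

(** Derivatives of the constituents are taken from the context; what remains is the equation
    between the computed derivative and the expected one. *)
Ltac derive_step :=
  lazymatch goal with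
  | |- is_derive (fun _ => ?k) _ _ => apply is_derive_const_R
  | |- is_derive (fun t => t) _ _ => apply is_derive_id_R
  | |- is_derive (fun t => _ + _) _ _ => apply is_derive_plus_R
  | |- is_derive (fun t => _ - _) _ _ => apply is_derive_minus_R
  | |- is_derive (fun t => - _) _ _ => apply is_derive_opp_R
  | |- is_derive (fun t => _ * _) _ _ => apply is_derive_mult_R
  | |- is_derive (fun t => _ / _) _ _ => apply is_derive_div; [ | | try lra ]
  | |- is_derive (fun t => _ ^ _) _ _ => apply is_derive_pow_R
  end.

Ltac derive := eapply is_derive_eq; [ repeat (eassumption || derive_step) | cbv beta ].

Lemma continuous_of_derive (g : R -> R) (x l : R) : is_derive g x l -> continuous g x.
Proof. intros Hg; apply (ex_derive_continuous g); exists l; exact Hg. Qed.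

Lemma continuous_neg_near (g : R -> R) (x : R) :
  continuous g x -> g x < 0 ->
  exists d, 0 < d /\ forall y, Rabs (y - x) < d -> g y < 0.
Proof.
intros Hc Hx.
destruct (Hc (fun z => z < 0)) as [d Hd].
- apply (open_lt 0), Hx.
- exists d; split; [apply cond_pos|]; intros y Hy; apply Hd; exact Hy.
Qed.

Lemma first_zero (g : R -> R) (a b : R) :
  a <= b -> (forall x, a <= x <= b -> continuous g x) -> g a < 0 -> 0 <= g b ->
  exists x, a < x <= b /\ g x = 0 /\ forall y, a <= y < x -> g y < 0.
Proof.
intros Hab Hc Ha Hb.
set (S := fun x => a <= x <= b /\ forall y, a <= y <= x -> g y < 0).
destruct (completeness S) as [x [Hub Hlub]].
- exists b; intros y [Hy _]; lra.
- exists a; split; [lra|]; intros y Hy; replace y with a by lra; exact Ha.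
- assert (Hax : a <= x).
  { apply Hub; split; [lra|]; intros y Hy; replace y with a by lra; exact Ha. }
  assert (Hxb : x <= b) by (apply Hlub; intros y [Hy _]; lra).
  assert (Hbelow : forall y, a <= y < x -> g y < 0).
  { intros y Hy.
    destruct (Classical_Prop.classic (exists z, S z /\ y < z)) as [[z [[Hz Hz'] Hyz]] | Hno].
    - apply Hz'; lra.
    - exfalso; apply (Rlt_irrefl y), (Rlt_le_trans _ x); [lra|].
      apply Hlub; intros z Hz; destruct (Rle_dec z y) as [|Hn]; [assumption|].
      exfalso; apply Hno; exists z; split; [exact Hz | lra]. }
  assert (Hx0 : g x = 0).
  { destruct (Rtotal_order (g x) 0) as [Hn | [He | Hp]]; [|exact He|]; exfalso.
    - destruct (continuous_neg_near g x) as [d [Hd Hd']]; [apply Hc; lra | exact Hn |].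
      assert (Hxb' : x < b) by (destruct (Req_dec x b) as [->|]; lra).
      set (z := Rmin b (x + d / 2)).
      assert (Hz : x < z) by (apply Rmin_case; lra).
      assert (Hz2 : z <= b) by apply Rmin_l.
      assert (Hz3 : z <= x + d / 2) by apply Rmin_r.
      enough (z <= x) by lra.
      apply Hub; split; [lra|]; intros y Hy.
      destruct (Rlt_dec y x); [apply Hbelow; lra|].
      apply Hd', Rabs_def1; lra.
    - assert (Hax' : a < x) by (destruct (Req_dec a x) as [->|]; lra).
      destruct (continuous_neg_near (fun t => - g t) x) as [d [Hd Hd']].
      + apply (continuous_opp g), Hc; lra.
      + lra.
      + set (z := Rmax a (x - d / 2)).
        assert (Hz : z < x) by (apply Rmax_case; lra).
        assert (Hz2 : a <= z) by apply Rmax_l.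
        assert (Hz3 : x - d / 2 <= z) by apply Rmax_r.
        specialize (Hbelow z ltac:(lra)).
        specialize (Hd' z ltac:(apply Rabs_def1; lra)); simpl in Hd'; lra. }
  exists x; split; [|split; assumption].
  split; [|exact Hxb].
  destruct (Req_dec a x) as [->|]; lra.
Qed.

Lemma last_zero (g : R -> R) (a b : R) :
  a <= b -> (forall x, a <= x <= b -> continuous g x) -> 0 <= g a -> g b < 0 ->
  exists x, a <= x < b /\ g x = 0 /\ forall y, x < y <= b -> g y < 0.
Proof.
intros Hab Hc Ha Hb.
destruct (first_zero (fun t => g (- t)) (- b) (- a)) as [x [Hx [Hx0 Hxn]]].
- lra.
- intros x Hx; apply (continuous_comp Ropp g).
  + apply (continuous_opp (fun t : R => t)), continuous_id.
  + apply Hc; lra.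
- rewrite Ropp_involutive; exact Hb.
- rewrite Ropp_involutive; exact Ha.
- exists (- x); split; [lra|]; split; [exact Hx0|].
  intros y Hy; rewrite <- (Ropp_involutive y); apply Hxn; lra.
Qed.

(** At a first zero a function that was negative cannot have a negative derivative. *)
Lemma negative_persists (g dg : R -> R) (a b : R) :
  a <= b -> (forall x, a <= x <= b -> is_derive g x (dg x)) -> g a < 0 ->
  (forall x, a < x <= b -> g x = 0 -> dg x < 0) -> g b < 0.
Proof.
intros Hab Hd Ha Hz.
destruct (Rlt_dec (g b) 0) as [|Hb]; [assumption | exfalso].
destruct (first_zero g a b) as [x [Hx [Hx0 Hxn]]]; auto; [|lra|].
- intros x Hx; exact (continuous_of_derive _ _ _ (Hd x Hx)).
- specialize (Hz x Hx Hx0).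
  assert (Hdx := proj1 (is_derive_Reals _ _ _) (Hd x ltac:(lra))).
  destruct (Hdx (- dg x) ltac:(lra)) as [d Hdd].
  assert (Hd0 := cond_pos d).
  set (k := Rmin (d / 2) (x - a)).
  assert (Hk : 0 < k) by (apply Rmin_case; lra).
  assert (Hk1 : k <= d / 2) by apply Rmin_l.
  assert (Hk2 : k <= x - a) by apply Rmin_r.
  specialize (Hdd (- k) ltac:(lra) ltac:(rewrite Rabs_Ropp, Rabs_pos_eq; lra)).
  rewrite Hx0 in Hdd.
  specialize (Hxn (x + - k) ltac:(lra)).
  assert (0 < (g (x + - k) - 0) / - k).
  { replace ((g (x + - k) - 0) / - k) with ((- g (x + - k)) / k) by (field; lra).
    apply Rdiv_lt_0_compat; lra. }
  apply Rabs_def2 in Hdd; lra.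
Qed.

(** Multiplying [g] by the integrating factor exp (- int a) makes it nonincreasing. *)
Lemma backward_gronwall (g dg a : R -> R) (lo hi x y : R) :
  lo < x -> x <= y -> y < hi ->
  (forall z, x <= z <= y -> is_derive g z (dg z)) ->
  (forall z, lo < z < hi -> continuous a z) ->
  (forall z, x <= z <= y -> dg z <= a z * g z) ->
  0 < g y -> 0 < g x.
Proof.
intros Hlo Hxy Hhi Hd Ha Hle Hy.
set (A := fun z => RInt a x z : R).
assert (HA : forall z, x <= z <= y -> is_derive A z (a z)).
{ intros z Hz; apply (is_derive_RInt a A x z); [|apply Ha; lra].
  apply (filter_imp (fun t => lo < t < hi)).
  - intros t Ht; apply (RInt_correct a x t), (ex_RInt_continuous a).
    intros v Hv; apply Ha; revert Hv; apply Rmin_case; apply Rmax_case; lra.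
  - apply filter_and; [apply (open_gt lo) | apply (open_lt hi)]; lra. }
assert (Hm : g y * exp (- A y) <= g x * exp (- A x)).
{ apply (nonincr_of_derive (fun z => g z * exp (- A z))
    (fun z => (dg z - a z * g z) * exp (- A z))); auto.
  - intros z Hz.
    assert (H1 := Hd z Hz); assert (H2 := HA z Hz).
    assert (H3 : is_derive (fun t => exp (- A t)) z (- a z * exp (- A z))).
    { apply (is_derive_comp_R exp (fun t => - A t)); [apply is_derive_exp | derive; ring]. }
    derive; ring.
  - intros z Hz; specialize (Hle z ltac:(lra)); assert (He0 := exp_pos (- A z)).
    nra. }
assert (0 < g y * exp (- A y)) by (apply Rmult_lt_0_compat; [exact Hy | apply exp_pos]).
assert (He0 := exp_pos (- A x)); nra.
Qed.

(** * The weight *)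

(** Here [dq], [Q] and [K] stand for q', the primitive of q and (Q / q)'. Of the
    behaviour at 0 only the limit of [Q] is retained. *)
Record weight (q dq Q K : R -> R) (H0 Hinf : R) : Prop := {
  w_q_pos : forall r, 0 < r -> 0 < q r;
  w_dq_pos : forall r, 0 < r -> 0 < dq r;
  w_Q_pos : forall r, 0 < r -> 0 < Q r;
  w_dq : forall r, 0 < r -> is_derive q r (dq r);
  w_dQ : forall r, 0 < r -> is_derive Q r (q r);
  w_K : forall r, 0 < r -> K r = 1 - Q r * dq r / (q r) ^ 2;
  w_log_decr : forall r1 r2, 0 < r1 -> r1 < r2 -> dq r2 / q r2 < dq r1 / q r1;
  w_K_nonincr : forall r1 r2, 0 < r1 -> r1 <= r2 -> K r2 <= K r1;
  w_K_lower : forall r, 0 < r -> Hinf <= K r;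
  w_K_upper : forall r, 0 < r -> K r <= H0;
  w_Hinf_pos : 0 < Hinf;
  w_H0_lt : H0 < / 2;
  w_excess_nondecr : forall r1 r2, 0 < r1 -> r1 <= r2 ->
    q r1 * (K r1 - Hinf) <= q r2 * (K r2 - Hinf);
  w_Q_start : forall e, 0 < e -> exists d, 0 < d /\ forall r, 0 < r < d -> Q r < e }.

Arguments w_q_pos {q dq Q K H0 Hinf}.
Arguments w_dq_pos {q dq Q K H0 Hinf}.
Arguments w_Q_pos {q dq Q K H0 Hinf}.
Arguments w_dq {q dq Q K H0 Hinf}.
Arguments w_dQ {q dq Q K H0 Hinf}.
Arguments w_K {q dq Q K H0 Hinf}.
Arguments w_log_decr {q dq Q K H0 Hinf}.
Arguments w_K_nonincr {q dq Q K H0 Hinf}.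
Arguments w_K_lower {q dq Q K H0 Hinf}.
Arguments w_K_upper {q dq Q K H0 Hinf}.
Arguments w_Hinf_pos {q dq Q K H0 Hinf}.
Arguments w_H0_lt {q dq Q K H0 Hinf}.
Arguments w_excess_nondecr {q dq Q K H0 Hinf}.
Arguments w_Q_start {q dq Q K H0 Hinf}.

Section Weight.
Context {q dq Q K : R -> R} {H0 Hinf : R} (W : weight q dq Q K H0 Hinf).

Lemma log_derive_pos r : 0 < r -> 0 < dq r / q r.
Proof.
intros Hr; apply Rdiv_lt_0_compat; [apply (w_dq_pos W) | apply (w_q_pos W)]; exact Hr.
Qed.

Lemma K_pos r : 0 < r -> 0 < K r.
Proof.
intros Hr; apply Rlt_le_trans with (1 := w_Hinf_pos W).
apply (w_K_lower W _ Hr).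
Qed.

Lemma K_lt_half r : 0 < r -> K r < / 2.
Proof.
intros Hr; apply Rle_lt_trans with (2 := w_H0_lt W).
apply (w_K_upper W _ Hr).
Qed.

Lemma q_incr r1 r2 : 0 < r1 -> r1 < r2 -> q r1 < q r2.
Proof.
intros H1 H2; apply (incr_of_derive q dq); [exact H2 | |].
- intros z Hz; apply (w_dq W); lra.
- intros z Hz; apply (w_dq_pos W); lra.
Qed.

Lemma q_nondecr r1 r2 : 0 < r1 -> r1 <= r2 -> q r1 <= q r2.
Proof.
intros H1 [H2 | <-]; [|lra]; left; apply q_incr; assumption.
Qed.

Lemma is_derive_ratio r : 0 < r -> is_derive (fun t => Q t / q t) r (K r).
Proof.
intros Hr.
assert (Hq := w_q_pos W r Hr).
assert (H1 := w_dq W r Hr).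
assert (H2 := w_dQ W r Hr).
derive.
rewrite (w_K W r Hr); field; lra.
Qed.

Lemma ratio_pos r : 0 < r -> 0 < Q r / q r.
Proof.
intros Hr; apply Rdiv_lt_0_compat; [apply (w_Q_pos W) | apply (w_q_pos W)]; exact Hr.
Qed.

Lemma ratio_incr r1 r2 : 0 < r1 -> r1 < r2 -> Q r1 / q r1 < Q r2 / q r2.
Proof.
intros H1 H2; apply (incr_of_derive (fun t => Q t / q t) K); [exact H2 | |].
- intros z Hz; apply is_derive_ratio; lra.
- intros z Hz; apply K_pos; lra.
Qed.

Lemma ratio_nondecr r1 r2 : 0 < r1 -> r1 <= r2 -> Q r1 / q r1 <= Q r2 / q r2.
Proof. intros H1 [H2 | <-]; [|lra]; left; apply ratio_incr; assumption. Qed.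

(** This identity trades q' for [K], so that quantities built on Q / q have derivatives in which
    the weight enters only through [K]. *)
Lemma ratio_log_derive r : 0 < r -> Q r / q r * (dq r / q r) = 1 - K r.
Proof.
intros Hr; rewrite (w_K W r Hr).
assert (Hq := w_q_pos W r Hr); field; lra.
Qed.

(** The logarithmic derivative of q / (Q / q) is (1 - 2 K) q / Q, and K < 1/2. *)
Lemma is_derive_inv_ratio2 r : 0 < r ->
  is_derive (fun t => q t / (Q t / q t)) r ((1 - 2 * K r) * q r / (Q r / q r) ^ 2).
Proof.
intros Hr.
assert (Hq := w_q_pos W r Hr).
assert (HQ := w_Q_pos W r Hr).
assert (H1 := w_dq W r Hr).
assert (H2 := is_derive_ratio r Hr).
assert (Hp := ratio_pos r Hr).
derive.
replace (dq r) with ((1 - K r) * (q r) ^ 2 / Q r).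
- field; split; lra.
- rewrite (w_K W r Hr); field; split; lra.
Qed.

Lemma ratio2_nonincr r1 r2 : 0 < r1 -> r1 <= r2 ->
  Q r2 / q r2 / q r2 <= Q r1 / q r1 / q r1.
Proof.
intros H1 H2.
assert (Hle : q r1 / (Q r1 / q r1) <= q r2 / (Q r2 / q r2)).
{ apply (nondecr_of_derive (fun t => q t / (Q t / q t))
    (fun r => (1 - 2 * K r) * q r / (Q r / q r) ^ 2)).
  - exact H2.
  - intros z Hz; apply is_derive_inv_ratio2; lra.
  - intros z Hz; apply Rmult_le_pos.
    + apply Rmult_le_pos; [|left; apply (w_q_pos W); lra].
      assert (Hk := K_lt_half z ltac:(lra)); lra.
    + left; apply Rinv_0_lt_compat, pow_lt, ratio_pos; lra. }
assert (P1 := ratio_pos r1 H1); assert (P2 := ratio_pos r2 ltac:(lra)).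
assert (Q1 := w_q_pos W r1 H1); assert (Q2 := w_q_pos W r2 ltac:(lra)).
assert (S1 := w_Q_pos W r1 H1); assert (S2 := w_Q_pos W r2 ltac:(lra)).
replace (Q r2 / q r2 / q r2) with (/ (q r2 / (Q r2 / q r2))) by (field; split; lra).
replace (Q r1 / q r1 / q r1) with (/ (q r1 / (Q r1 / q r1))) by (field; split; lra).
apply Rinv_le_contravar; [apply Rdiv_lt_0_compat; lra | exact Hle].
Qed.

(** Since Q / q grows at most linearly and K stays below H0 < 1/2, the derivative of
    q / (Q / q) is at least a multiple of 1 / r. *)
Lemma ratio2_vanishes e : 0 < e ->
  exists r0, 0 < r0 /\ forall r, r0 <= r -> Q r / q r / q r < e.
Proof.
intros He.
set (R1 := Q 1 / q 1).
assert (HR1 : 0 < R1) by (apply ratio_pos; lra).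
assert (Hlin : forall r, 1 <= r -> Q r / q r <= (R1 + 1) * r).
{ intros r Hr.
  enough (Q r / q r - r <= R1 - 1) by nra.
  apply (nonincr_of_derive (fun t => Q t / q t - t) (fun t => K t - 1) 1 r Hr).
  - intros z Hz; assert (Hd := is_derive_ratio z ltac:(lra)); derive; ring.
  - intros z Hz; assert (Hk := K_lt_half z ltac:(lra)); lra. }
set (g := fun t => q t / (Q t / q t)).
assert (Hg1 : 0 < g 1).
{ apply Rdiv_lt_0_compat; [apply (w_q_pos W); lra | exact HR1]. }
set (k := g 1 * (1 - 2 * H0) / (R1 + 1)).
assert (Hk : 0 < k).
{ apply Rdiv_lt_0_compat; [|lra]; apply Rmult_lt_0_compat; [exact Hg1|].
  assert (H := w_H0_lt W); lra. }
assert (Hgpos : forall r, 0 < r -> 0 < g r).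
{ intros r Hr; apply Rdiv_lt_0_compat; [apply (w_q_pos W); lra | apply ratio_pos; lra]. }
assert (Hinv : forall r, 0 < r -> Q r / q r / q r = / g r).
{ intros r Hr; unfold g.
  assert (Q1 := w_q_pos W r Hr); assert (Q2 := w_Q_pos W r Hr).
  field; split; lra. }
assert (Hlog : forall r, 1 <= r -> k * ln r <= g r).
{ intros r Hr.
  assert (Hle : g 1 - k * ln 1 <= g r - k * ln r).
  { apply (nondecr_of_derive (fun t => g t - k * ln t)
      (fun t => (1 - 2 * K t) * q t / (Q t / q t) ^ 2 - k * / t)); [exact Hr | |].
    - intros z Hz.
      assert (H1 : is_derive g z _) by (apply is_derive_inv_ratio2; lra).
      assert (H2 : is_derive ln z (/ z)) by (apply is_derive_ln; lra).
      derive; ring.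
    - intros z Hz.
      assert (Hz0 : 0 < z) by lra.
      assert (HA := ratio_pos z Hz0).
      assert (HAl := Hlin z ltac:(lra)).
      assert (Hgz : g 1 <= g z).
      { rewrite <- (Rinv_inv (g 1)), <- (Rinv_inv (g z)).
        apply Rinv_le_contravar; [apply Rinv_0_lt_compat, Hgpos; lra|].
        rewrite <- !Hinv by lra; apply ratio2_nonincr; lra. }
      replace ((1 - 2 * K z) * q z / (Q z / q z) ^ 2) with
        (g z * (1 - 2 * K z) * / (Q z / q z)).
      + assert (Hb := w_K_upper W z Hz0).
        assert (Hh := w_H0_lt W).
        assert (Hi : / ((R1 + 1) * z) <= / (Q z / q z)) by (apply Rinv_le_contravar; lra).
        assert (Hi0 : 0 < / ((R1 + 1) * z)) by (apply Rinv_0_lt_compat, Rmult_lt_0_compat; lra).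
        assert (Hn : g 1 * (1 - 2 * H0) <= g z * (1 - 2 * K z))
          by (apply Rmult_le_compat; lra).
        assert (Hm : g 1 * (1 - 2 * H0) * / ((R1 + 1) * z) <= g z * (1 - 2 * K z) * / (Q z / q z)).
        { apply Rmult_le_compat; try lra; apply Rmult_le_pos; lra. }
        replace (k * / z) with (g 1 * (1 - 2 * H0) * / ((R1 + 1) * z)).
        * lra.
        * unfold k; field; split; lra.
      + unfold g; assert (Hq := w_q_pos W z Hz0); assert (HQ := w_Q_pos W z Hz0).
        field; split; lra. }
  rewrite ln_1 in Hle; lra. }
exists (exp ((1 + / e) / k)); split; [apply exp_pos|].
intros r Hr.
assert (Hr0 : 0 < r) by (apply Rlt_le_trans with (2 := Hr), exp_pos).
assert (Hie : 0 < / e) by (apply Rinv_0_lt_compat, He).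
assert (Hexp : 1 <= exp ((1 + / e) / k)).
{ rewrite <- exp_0 at 1; left; apply exp_increasing, Rdiv_lt_0_compat; lra. }
assert (Hl : (1 + / e) / k <= ln r).
{ rewrite <- (ln_exp ((1 + / e) / k)).
  destruct Hr as [Hr | ->]; [left; apply ln_increasing; [apply exp_pos | exact Hr] | lra]. }
assert (Hg : / e < g r).
{ apply Rlt_le_trans with (k * ln r); [|apply Hlog; lra].
  apply Rlt_le_trans with (k * ((1 + / e) / k)).
  - replace (k * ((1 + / e) / k)) with (1 + / e) by (field; lra); lra.
  - apply Rmult_le_compat_l; lra. }
rewrite Hinv, <- (Rinv_inv e) by lra.
apply Rinv_lt_contravar; [apply Rmult_lt_0_compat; [lra | apply Hgpos, Hr0] | exact Hg].
Qed.

End Weight.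

(** * The nonlinearity *)

Record nonlinearity (c : Rbar) (f F dG : R -> R) (b beta Hinf : R) : Prop := {
  n_b_pos : 0 < b;
  n_b_beta : b < beta;
  n_f_cont : forall s, 0 <= s -> Rbar_lt s c -> continuous f s;
  n_dF : forall s, 0 <= s -> Rbar_lt s c -> is_derive F s (f s);
  n_F_zero : F 0 = 0;
  n_F_beta : F beta = 0;
  n_beta_c : Rbar_lt beta c;
  n_f_pos : forall s, b < s -> Rbar_lt s c -> 0 < f s;
  n_f_nonpos : forall s, 0 <= s <= b -> f s <= 0;
  n_dG : forall s, b < s -> Rbar_lt s c -> is_derive (fun t => F t / f t) s (dG s);
  n_dG_lower : forall s, beta < s -> Rbar_lt s c -> / 2 - Hinf <= dG s }.

Arguments n_b_pos {c f F dG b beta Hinf}.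
Arguments n_b_beta {c f F dG b beta Hinf}.
Arguments n_f_cont {c f F dG b beta Hinf}.
Arguments n_dF {c f F dG b beta Hinf}.
Arguments n_F_zero {c f F dG b beta Hinf}.
Arguments n_F_beta {c f F dG b beta Hinf}.
Arguments n_beta_c {c f F dG b beta Hinf}.
Arguments n_f_pos {c f F dG b beta Hinf}.
Arguments n_f_nonpos {c f F dG b beta Hinf}.
Arguments n_dG {c f F dG b beta Hinf}.
Arguments n_dG_lower {c f F dG b beta Hinf}.

Lemma Rbar_le_lt_trans_R (x y : R) (c : Rbar) : x <= y -> Rbar_lt y c -> Rbar_lt x c.
Proof. exact (Rbar_le_lt_trans x y c). Qed.

Section Nonlinearity.
Context {c : Rbar} {f F dG : R -> R} {b beta Hinf : R}.
Context (N : nonlinearity c f F dG b beta Hinf).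

Lemma F_nondecr s t : b <= s -> s <= t -> Rbar_lt t c -> F s <= F t.
Proof.
intros Hs Hst Ht; assert (Hb := n_b_pos N).
apply (nondecr_of_derive F f); [exact Hst | |]; intros z Hz.
- apply (n_dF N); [lra | apply (Rbar_le_lt_trans_R z t); [lra | exact Ht]].
- left; apply (n_f_pos N); [lra | apply (Rbar_le_lt_trans_R z t); [lra | exact Ht]].
Qed.

Lemma F_incr s t : b <= s -> s < t -> Rbar_lt t c -> F s < F t.
Proof.
intros Hs Hst Ht; assert (Hb := n_b_pos N).
apply (incr_of_derive F f); [exact Hst | |]; intros z Hz.
- apply (n_dF N); [lra | apply (Rbar_le_lt_trans_R z t); [lra | exact Ht]].
- apply (n_f_pos N); [lra | apply (Rbar_le_lt_trans_R z t); [lra | exact Ht]].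
Qed.

Lemma F_nonpos s : 0 <= s <= beta -> F s <= 0.
Proof.
intros Hs; assert (Hb := n_b_pos N); assert (Hbb := n_b_beta N); assert (Hc := n_beta_c N).
destruct (Rle_dec b s).
- rewrite <- (n_F_beta N); apply F_nondecr; [lra | lra | exact Hc].
- rewrite <- (n_F_zero N); apply (nonincr_of_derive F f); [lra | |]; intros z Hz.
  + apply (n_dF N); [lra | apply (Rbar_le_lt_trans_R z beta); [lra | exact Hc]].
  + apply (n_f_nonpos N); lra.
Qed.

Lemma F_neg s : b <= s < beta -> F s < 0.
Proof.
intros Hs; rewrite <- (n_F_beta N); apply F_incr; [lra | lra | apply (n_beta_c N)].
Qed.

Lemma F_pos s : beta < s -> Rbar_lt s c -> 0 < F s.
Proof.
intros Hs Hc; rewrite <- (n_F_beta N); apply F_incr; [|exact Hs | exact Hc].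
assert (Hbb := n_b_beta N); lra.
Qed.

Lemma F_small e : 0 < e -> exists d, 0 < d /\ forall s, 0 < s < d -> - F s < e.
Proof.
intros He.
assert (Hc : Rbar_lt 0 c).
{ assert (Hb := n_b_pos N); assert (Hbb := n_b_beta N).
  apply (Rbar_le_lt_trans_R 0 beta); [lra | apply (n_beta_c N)]. }
assert (HF := n_dF N 0 (Rle_refl 0) Hc).
destruct (continuous_neg_near (fun s => - F s - e) 0) as [d [Hd Hd']].
- eapply continuous_of_derive; derive; reflexivity.
- rewrite (n_F_zero N); lra.
- exists d; split; [exact Hd|]; intros s Hs.
  specialize (Hd' s ltac:(apply Rabs_def1; lra)); simpl in Hd'; lra.
Qed.

End Nonlinearity.

(** * Inverse functions of decreasing solutions *)

(** The graph of a decreasing solution [u] of height [alpha], with the value s of [u] as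
    the independent variable: [r s] is the point where [u] equals s, [p s] is the slope
    - u' there. *)
Record profile (q dq Q f F : R -> R) (alpha : R) (r p : R -> R) : Prop := {
  p_r_pos : forall s, 0 < s < alpha -> 0 < r s;
  p_p_pos : forall s, 0 < s < alpha -> 0 < p s;
  p_dr : forall s, 0 < s < alpha -> is_derive r s (- / p s);
  p_dp : forall s, 0 < s < alpha -> is_derive p s (dq (r s) / q (r s) - f s / p s);
  p_energy : forall s, 0 < s < alpha -> 0 < p s ^ 2 + 2 * F s;
  p_start : forall e, 0 < e -> exists s1, 0 < s1 < alpha /\
    forall s, s1 < s < alpha -> r s < e /\ p s < e;
  p_end : forall e s1, 0 < e -> 0 < s1 -> exists s, 0 < s < s1 /\ s < alpha /\
    Q (r s) / q (r s) * sqrt (p s ^ 2 + 2 * F s) < e }.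

Arguments p_r_pos {q dq Q f F alpha r p}.
Arguments p_p_pos {q dq Q f F alpha r p}.
Arguments p_dr {q dq Q f F alpha r p}.
Arguments p_dp {q dq Q f F alpha r p}.
Arguments p_energy {q dq Q f F alpha r p}.
Arguments p_start {q dq Q f F alpha r p}.
Arguments p_end {q dq Q f F alpha r p}.

Section Profile.
Context {q dq Q K : R -> R} {H0 Hinf : R} (W : weight q dq Q K H0 Hinf).
Context {c : Rbar} {f F dG : R -> R} {b beta : R}.
Context (N : nonlinearity c f F dG b beta Hinf).
Context {alpha : R} (Hbeta : beta < alpha) (Hc : Rbar_lt alpha c) {r p : R -> R}.
Context (U : profile q dq Q f F alpha r p).

(** The flux - q u'. *)
Definition flux s := q (r s) * p s.

(** The Pohozaev identity for the multiplier Q u' + q F / f: the factor F / f makes the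
    terms with F cancel in the derivative. *)
Definition pohozaev s := Q (r s) * (p s ^ 2 + 2 * F s) - 2 * flux s * (F s / f s).

(** Chosen so that [pohozaev] is 2 [flux] ([energy_ratio] - F / f). *)
Definition energy_ratio s := Q (r s) / q (r s) * (p s ^ 2 / 2 + F s) / p s.

(** For q = r^(n-1) this is r sqrt (u'^2 + 2 F(u)) / n. *)
Definition scaled_speed s := Q (r s) / q (r s) * sqrt (p s ^ 2 + 2 * F s).

Lemma below_alpha s : s <= alpha -> Rbar_lt s c.
Proof. intros Hs; apply (Rbar_le_lt_trans_R s alpha); assumption. Qed.

Lemma r_decr s t : 0 < s -> s < t -> t < alpha -> r t < r s.
Proof.
intros Hs Hst Ht; apply (decr_of_derive r (fun s => - / p s)); [exact Hst | |]; intros z Hz.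
- apply (p_dr U); lra.
- assert (0 < / p z) by (apply Rinv_0_lt_compat, (p_p_pos U); lra); lra.
Qed.

Lemma is_derive_q_r s : 0 < s < alpha -> is_derive (fun t => q (r t)) s (- dq (r s) / p s).
Proof.
intros Hs; assert (Hr := p_r_pos U s Hs); assert (Hp := p_p_pos U s Hs).
eapply is_derive_eq; [apply is_derive_comp_R; [apply (w_dq W), Hr | apply (p_dr U), Hs]|].
field; lra.
Qed.

Lemma is_derive_Q_r s : 0 < s < alpha -> is_derive (fun t => Q (r t)) s (- q (r s) / p s).
Proof.
intros Hs; assert (Hr := p_r_pos U s Hs); assert (Hp := p_p_pos U s Hs).
eapply is_derive_eq; [apply is_derive_comp_R; [apply (w_dQ W), Hr | apply (p_dr U), Hs]|].
field; lra.
Qed.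

Lemma is_derive_ratio_r s : 0 < s < alpha ->
  is_derive (fun t => Q (r t) / q (r t)) s (- K (r s) / p s).
Proof.
intros Hs; assert (Hr := p_r_pos U s Hs); assert (Hp := p_p_pos U s Hs).
eapply is_derive_eq.
- apply (is_derive_comp_R (fun t => Q t / q t) r);
    [apply (is_derive_ratio W), Hr | apply (p_dr U), Hs].
- field; lra.
Qed.

Lemma is_derive_flux s : 0 < s < alpha -> is_derive flux s (- q (r s) * f s / p s).
Proof.
intros Hs; assert (Hr := p_r_pos U s Hs); assert (Hp := p_p_pos U s Hs).
assert (Hq := w_q_pos W _ Hr).
assert (H1 := is_derive_q_r s Hs); assert (H2 := p_dp U s Hs).
unfold flux; derive; field; lra.
Qed.

Lemma flux_pos s : 0 < s < alpha -> 0 < flux s.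
Proof.
intros Hs; apply Rmult_lt_0_compat; [apply (w_q_pos W), (p_r_pos U), Hs | apply (p_p_pos U), Hs].
Qed.

Lemma is_derive_energy_ratio s : 0 < s < alpha ->
  is_derive energy_ratio s
    (/ 2 - K (r s) + (energy_ratio s * f s - F s) / p s ^ 2).
Proof.
intros Hs; assert (Hr := p_r_pos U s Hs); assert (Hp := p_p_pos U s Hs).
assert (Hq := w_q_pos W _ Hr).
assert (H1 := is_derive_ratio_r s Hs); assert (H2 := p_dp U s Hs).
assert (H3 := n_dF N s ltac:(lra) (below_alpha s ltac:(lra))).
assert (H4 := ratio_log_derive W _ Hr).
unfold energy_ratio; derive; simpl.
replace (dq (r s) / q (r s)) with ((1 - K (r s)) / (Q (r s) / q (r s))).
- assert (HQ := w_Q_pos W _ Hr); field; repeat split; lra.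
- rewrite <- H4; assert (HQ := w_Q_pos W _ Hr); field; split; lra.
Qed.

Lemma is_derive_scaled_speed s : 0 < s < alpha ->
  is_derive scaled_speed s
    ((1 - K (r s)) * (p s / sqrt (p s ^ 2 + 2 * F s))
     - K (r s) * (sqrt (p s ^ 2 + 2 * F s) / p s)).
Proof.
intros Hs; assert (Hr := p_r_pos U s Hs); assert (Hp := p_p_pos U s Hs).
assert (Hq := w_q_pos W _ Hr).
assert (H1 := is_derive_ratio_r s Hs); assert (H2 := p_dp U s Hs).
assert (H3 := n_dF N s ltac:(lra) (below_alpha s ltac:(lra))).
assert (H4 := ratio_log_derive W _ Hr).
assert (He := p_energy U s Hs).
assert (Hw := sqrt_lt_R0 _ He).
assert (H5 : is_derive (fun t => sqrt (p t ^ 2 + 2 * F t)) s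
  (dq (r s) / q (r s) * p s / sqrt (p s ^ 2 + 2 * F s))).
{ eapply is_derive_eq.
  - apply (is_derive_sqrt (fun t => p t ^ 2 + 2 * F t)); [derive; reflexivity | exact He].
  - set (w := sqrt (p s ^ 2 + 2 * F s)) in *; simpl; field; repeat split; lra. }
unfold scaled_speed; derive.
set (w := sqrt (p s ^ 2 + 2 * F s)) in *; rewrite <- H4; field; repeat split; lra.
Qed.

Lemma is_derive_pohozaev s : b < s < alpha ->
  is_derive pohozaev s (flux s * (1 - 2 * K (r s) - 2 * dG s)).
Proof.
intros Hs'; assert (Hb := n_b_pos N); assert (Hs : 0 < s < alpha) by lra.
assert (Hr := p_r_pos U s Hs); assert (Hp := p_p_pos U s Hs).
assert (Hq := w_q_pos W _ Hr).
assert (Hcs := below_alpha s ltac:(lra)).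
assert (H1 := is_derive_Q_r s Hs); assert (H2 := p_dp U s Hs).
assert (H3 := n_dF N s ltac:(lra) Hcs).
assert (H4 := is_derive_flux s Hs).
assert (H5 := n_dG N s ltac:(lra) Hcs).
assert (Hf := n_f_pos N s ltac:(lra) Hcs).
unfold pohozaev; derive; simpl.
rewrite (w_K W _ Hr); unfold flux; field; repeat split; lra.
Qed.

(** The factor 1 - 2 K - 2 (F/f)' is at most 2 (Hinf - K), and K >= Hinf. *)
Lemma pohozaev_nonincr s t : beta < s -> s <= t -> t < alpha -> pohozaev t <= pohozaev s.
Proof.
intros Hs Hst Ht; assert (Hb := n_b_pos N); assert (Hbb := n_b_beta N).
apply (nonincr_of_derive pohozaev (fun s => flux s * (1 - 2 * K (r s) - 2 * dG s)));
  [exact Hst | |]; intros z Hz.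
- apply is_derive_pohozaev; lra.
- assert (Hfl := flux_pos z ltac:(lra)).
  assert (HK := w_K_lower W (r z) (p_r_pos U z ltac:(lra))).
  assert (Hg := n_dG_lower N z ltac:(lra) (below_alpha z ltac:(lra))).
  nra.
Qed.

Lemma start_near e : 0 < e -> exists s1, beta < s1 < alpha /\
  forall s, s1 < s < alpha -> r s < e /\ p s < e.
Proof.
intros He; destruct (p_start U e He) as [s1 [Hs1 Hst]].
assert (Hm1 := Rmax_l ((beta + alpha) / 2) s1).
assert (Hm2 := Rmax_r ((beta + alpha) / 2) s1).
exists (Rmax ((beta + alpha) / 2) s1); split; [split; [lra | apply Rmax_lub_lt; lra]|].
intros s Hs; apply Hst; lra.
Qed.

(** The only positive term is bounded by Q times the energy, and Q vanishes at 0. *)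
Lemma pohozaev_start e : 0 < e ->
  exists s1, beta < s1 < alpha /\ forall s, s1 < s < alpha -> pohozaev s < e.
Proof.
intros He; assert (Hb := n_b_pos N); assert (Hbb := n_b_beta N).
assert (HFa := F_pos N alpha Hbeta Hc).
destruct (w_Q_start W (e / (1 + 2 * F alpha))) as [d [Hd HQ]]; [apply Rdiv_lt_0_compat; lra|].
destruct (start_near (Rmin 1 d)) as [s1 [Hs1 Hst]]; [apply Rmin_case; lra|].
exists s1; split; [exact Hs1|]; intros s Hs.
destruct (Hst s Hs) as [Hr Hp].
assert (Hm1 := Rmin_l 1 d); assert (Hm2 := Rmin_r 1 d).
assert (Hs0 : 0 < s < alpha) by lra.
assert (Hr0 := p_r_pos U s Hs0); assert (Hp0 := p_p_pos U s Hs0).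
assert (HFs := F_pos N s ltac:(lra) (below_alpha s ltac:(lra))).
assert (HFl := F_nondecr N s alpha ltac:(lra) ltac:(lra) Hc).
assert (Hf := n_f_pos N s ltac:(lra) (below_alpha s ltac:(lra))).
assert (HG : 0 < F s / f s) by (apply Rdiv_lt_0_compat; lra).
assert (Hfl := flux_pos s Hs0).
specialize (HQ (r s) ltac:(lra)).
assert (HQ0 := w_Q_pos W _ Hr0).
assert (Hmul : Q (r s) * (1 + 2 * F alpha) < e).
{ apply (Rmult_lt_compat_r (1 + 2 * F alpha)) in HQ; [|lra].
  replace (e / (1 + 2 * F alpha) * (1 + 2 * F alpha)) with e in HQ by (field; lra); exact HQ. }
unfold pohozaev.
assert (0 < flux s * (F s / f s)) by (apply Rmult_lt_0_compat; lra).
assert (Q (r s) * (p s ^ 2 + 2 * F s) <= Q (r s) * (1 + 2 * F alpha)) by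
  (apply Rmult_le_compat_l; nra).
lra.
Qed.

(** The function is nonincreasing in s and its negative part tends to 0 as s tends to alpha,
    because p does while q and F / f stay bounded. *)
Lemma pohozaev_nonneg s : beta < s < alpha -> 0 <= pohozaev s.
Proof.
intros Hs; assert (Hb := n_b_pos N); assert (Hbb := n_b_beta N).
apply le_epsilon; intros e He.
assert (HcG := continuous_of_derive _ _ _ (n_dG N alpha ltac:(lra) Hc)).
set (M := F alpha / f alpha + 1).
assert (HM : 0 < M).
{ assert (Hf := n_f_pos N alpha ltac:(lra) Hc).
  assert (HFa := F_pos N alpha Hbeta Hc).
  assert (0 < F alpha / f alpha) by (apply Rdiv_lt_0_compat; lra).
  unfold M; lra. }
destruct (continuous_neg_near (fun t => F t / f t - M) alpha) as [d [Hd HG]].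
- apply (continuous_minus (fun t => F t / f t) (fun _ => M)); [exact HcG | apply continuous_const].
- unfold M; lra.
- assert (Hq1 := w_q_pos W 1 ltac:(lra)).
  assert (Hk : 0 < 2 * q 1 * M) by nra.
  destruct (start_near (Rmin 1 (e / (2 * q 1 * M)))) as [s1 [Hs1 Hst]].
  { apply Rmin_case; [lra | apply Rdiv_lt_0_compat; lra]. }
  set (l := Rmax s (Rmax s1 (alpha - d))).
  assert (Hl1 : s <= l) by apply Rmax_l.
  assert (Hl2 : s1 <= l) by (apply Rle_trans with (2 := Rmax_r _ _), Rmax_l).
  assert (Hl3 : alpha - d <= l) by (apply Rle_trans with (2 := Rmax_r _ _), Rmax_r).
  assert (Hl4 : l < alpha) by (repeat apply Rmax_lub_lt; lra).
  set (t := (l + alpha) / 2).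
  assert (Ht : l < t < alpha) by (unfold t; lra).
  assert (Hmon := pohozaev_nonincr s t ltac:(lra) ltac:(lra) ltac:(lra)).
  destruct (Hst t ltac:(lra)) as [Hr Hp].
  assert (Hm1 := Rmin_l 1 (e / (2 * q 1 * M))); assert (Hm2 := Rmin_r 1 (e / (2 * q 1 * M))).
  assert (Ht0 : 0 < t < alpha) by lra.
  assert (Hr0 := p_r_pos U t Ht0); assert (Hp0 := p_p_pos U t Ht0).
  assert (HQ0 := w_Q_pos W _ Hr0).
  assert (HFs := F_pos N t ltac:(lra) (below_alpha t ltac:(lra))).
  specialize (HG t ltac:(apply Rabs_def1; lra)); simpl in HG.
  assert (Hf := n_f_pos N t ltac:(lra) (below_alpha t ltac:(lra))).
  assert (HG0 : 0 < F t / f t) by (apply Rdiv_lt_0_compat; lra).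
  assert (Hqr := q_nondecr W (r t) 1 Hr0 ltac:(lra)).
  assert (Hqr0 := w_q_pos W _ Hr0).
  assert (Hpe : 2 * q 1 * M * p t < e).
  { apply Rlt_le_trans with (2 * q 1 * M * (e / (2 * q 1 * M))).
    - apply Rmult_lt_compat_l; lra.
    - right; field; split; lra. }
  assert (H1 : flux t <= q 1 * p t) by (apply Rmult_le_compat_r; lra).
  assert (H2 : flux t * (F t / f t) <= q 1 * p t * M).
  { apply Rmult_le_compat; [left; apply flux_pos, Ht0 | lra | exact H1 | lra]. }
  assert (H3 : 0 < Q (r t) * (p t ^ 2 + 2 * F t)) by (apply Rmult_lt_0_compat; nra).
  unfold pohozaev in Hmon at 1; lra.
Qed.

Lemma energy_ratio_lower s : beta < s < alpha -> F s <= energy_ratio s * f s.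
Proof.
intros Hs; assert (Hb := n_b_pos N); assert (Hbb := n_b_beta N).
assert (HP := pohozaev_nonneg s Hs).
assert (Hs0 : 0 < s < alpha) by lra.
assert (Hr0 := p_r_pos U s Hs0); assert (Hp0 := p_p_pos U s Hs0).
assert (Hq := w_q_pos W _ Hr0).
assert (Hf := n_f_pos N s ltac:(lra) (below_alpha s ltac:(lra))).
assert (Hfl := flux_pos s Hs0).
assert (He : pohozaev s = 2 * flux s / f s * (energy_ratio s * f s - F s)).
{ unfold pohozaev, energy_ratio, flux; field; repeat split; lra. }
rewrite He in HP.
assert (0 < 2 * flux s / f s) by (apply Rdiv_lt_0_compat; lra).
nra.
Qed.

(** Since Q / q is bounded below for s < beta, the scaled speed controls p up to F(s), which
    tends to 0. *)
Lemma slope_end e s1 : 0 < e -> 0 < s1 -> exists s, 0 < s < s1 /\ s < alpha /\ p s < e.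
Proof.
intros He Hs1; assert (Hb := n_b_pos N); assert (Hbb := n_b_beta N).
destruct (F_small N (e ^ 2 / 4)) as [d [Hd HF]]; [nra|].
set (k := Q (r beta) / q (r beta)).
assert (Hk : 0 < k) by (apply (ratio_pos W), (p_r_pos U); lra).
destruct (p_end U (k * (e / 2)) (Rmin s1 (Rmin d beta))) as [s [Hs [Hsa Hw]]].
- apply Rmult_lt_0_compat; lra.
- repeat apply Rmin_case; lra.
- assert (Hm1 := Rmin_l s1 (Rmin d beta)); assert (Hm2 := Rmin_r s1 (Rmin d beta)).
  assert (Hm3 := Rmin_l d beta); assert (Hm4 := Rmin_r d beta).
  exists s; split; [lra|]; split; [exact Hsa|].
  specialize (HF s ltac:(lra)).
  assert (HA : k <= Q (r s) / q (r s)).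
  { apply (ratio_nondecr W); [apply (p_r_pos U); lra|].
    left; apply r_decr; lra. }
  assert (He0 := p_energy U s ltac:(lra)).
  assert (Hp0 := p_p_pos U s ltac:(lra)).
  assert (Hw0 := sqrt_lt_R0 _ He0).
  assert (Hsq := pow2_sqrt _ (Rlt_le _ _ He0)).
  set (w := sqrt (p s ^ 2 + 2 * F s)) in *.
  assert (Hwe : w < e / 2).
  { apply (Rmult_lt_reg_l k); [exact Hk|]; apply Rle_lt_trans with (2 := Hw).
    apply Rmult_le_compat_r; lra. }
  nra.
Qed.

End Profile.

Arguments flux : clear implicits.
Arguments pohozaev : clear implicits.
Arguments energy_ratio : clear implicits.
Arguments scaled_speed : clear implicits.

(** * Two solutions of different heights *)

Section Comparison.
Context {q dq Q K : R -> R} {H0 Hinf : R} (W : weight q dq Q K H0 Hinf).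
Context {c : Rbar} {f F dG : R -> R} {b beta : R}.
Context (N : nonlinearity c f F dG b beta Hinf).
Context {alpha1 alpha2 : R} (Hbeta : beta < alpha1) (Halpha : alpha1 < alpha2).
Context (Hc : Rbar_lt alpha2 c) {r1 p1 r2 p2 : R -> R}.
Context (U1 : profile q dq Q f F alpha1 r1 p1) (U2 : profile q dq Q f F alpha2 r2 p2).

Let Hb : 0 < b := n_b_pos N.
Let Hbb : b < beta := n_b_beta N.
Let Hc1 : Rbar_lt alpha1 c := Rbar_le_lt_trans_R alpha1 alpha2 c (Rlt_le _ _ Halpha) Hc.
Let Hbeta2 : beta < alpha2 := Rlt_trans _ _ _ Hbeta Halpha.

Notation flux1 := (flux q r1 p1).
Notation flux2 := (flux q r2 p2).
Notation pohozaev1 := (pohozaev q Q f F r1 p1).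
Notation pohozaev2 := (pohozaev q Q f F r2 p2).
Notation energy_ratio1 := (energy_ratio q Q F r1 p1).
Notation energy_ratio2 := (energy_ratio q Q F r2 p2).
Notation scaled_speed1 := (scaled_speed q Q F r1 p1).
Notation scaled_speed2 := (scaled_speed q Q F r2 p2).

Lemma below_alpha1 s : s <= alpha1 -> Rbar_lt s c.
Proof. intros Hs; apply (Rbar_le_lt_trans_R s alpha1); assumption. Qed.

Lemma ordered_near_start : exists s1, beta < s1 < alpha1 /\
  forall s, s1 < s < alpha1 -> r1 s < r2 s /\ p1 s < p2 s.
Proof.
assert (Ha : 0 < alpha1 < alpha2) by lra.
assert (Hr := p_r_pos U2 _ Ha); assert (Hp := p_p_pos U2 _ Ha).
assert (Hnear : forall g l, is_derive g alpha1 l -> 0 < g alpha1 ->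
  exists d, 0 < d /\ forall s, Rabs (s - alpha1) < d -> g alpha1 / 2 < g s).
{ intros g l Hg Hg0.
  destruct (continuous_neg_near (fun s => g alpha1 / 2 - g s) alpha1) as [d [Hd Hd']].
  - eapply continuous_of_derive; derive; reflexivity.
  - lra.
  - exists d; split; [exact Hd|]; intros s Hs; specialize (Hd' s Hs); simpl in Hd'; lra. }
destruct (Hnear r2 _ (p_dr U2 _ Ha) Hr) as [d1 [Hd1 Hr2]].
destruct (Hnear p2 _ (p_dp U2 _ Ha) Hp) as [d2 [Hd2 Hp2]].
destruct (start_near Hbeta U1 (Rmin (r2 alpha1 / 2) (p2 alpha1 / 2)))
  as [s1 [Hs1 Hst]]; [apply Rmin_case; lra|].
assert (Hm1 := Rmin_l (r2 alpha1 / 2) (p2 alpha1 / 2)).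
assert (Hm2 := Rmin_r (r2 alpha1 / 2) (p2 alpha1 / 2)).
set (s2 := Rmax s1 (Rmax (alpha1 - d1) (alpha1 - d2))).
assert (Hl1 : s1 <= s2) by apply Rmax_l.
assert (Hl2 : alpha1 - d1 <= s2) by (apply Rle_trans with (2 := Rmax_r _ _), Rmax_l).
assert (Hl3 : alpha1 - d2 <= s2) by (apply Rle_trans with (2 := Rmax_r _ _), Rmax_r).
assert (Hl4 : s2 < alpha1) by (repeat apply Rmax_lub_lt; lra).
exists s2; split; [lra|]; intros s Hs.
destruct (Hst s ltac:(lra)) as [Hr1 Hp1].
specialize (Hr2 s ltac:(apply Rabs_def1; lra)).
specialize (Hp2 s ltac:(apply Rabs_def1; lra)).
lra.
Qed.

(** In (p2 - p1)' the friction terms q'/q have the right sign as long as r1 <= r2, because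
    q'/q decreases; this leaves (p2 - p1)' <= f (p2 - p1) / (p1 p2). *)
Lemma slopes_ordered x : 0 < x < alpha1 -> (forall s, x <= s < alpha1 -> r1 s <= r2 s) ->
  p1 x < p2 x.
Proof.
intros Hx Hr.
destruct ordered_near_start as [s1 [Hs1 Hst]].
set (y := (Rmax x s1 + alpha1) / 2).
assert (Hm1 := Rmax_l x s1); assert (Hm2 := Rmax_r x s1).
assert (Hm3 : Rmax x s1 < alpha1) by (apply Rmax_lub_lt; lra).
assert (Hy : Rmax x s1 < y < alpha1) by (unfold y; lra).
enough (0 < p2 x - p1 x) by lra.
apply (backward_gronwall (fun s => p2 s - p1 s)
  (fun s => (dq (r2 s) / q (r2 s) - f s / p2 s) - (dq (r1 s) / q (r1 s) - f s / p1 s))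
  (fun s => f s * / (p1 s * p2 s)) 0 alpha1 x y); try lra.
- intros z Hz; assert (G1 := p_dp U1 z ltac:(lra)); assert (G2 := p_dp U2 z ltac:(lra)).
  derive; reflexivity.
- intros z Hz.
  assert (G1 := p_dp U1 z ltac:(lra)); assert (G2 := p_dp U2 z ltac:(lra)).
  assert (P1 := p_p_pos U1 z ltac:(lra)); assert (P2 := p_p_pos U2 z ltac:(lra)).
  apply (continuous_mult f (fun s => / (p1 s * p2 s))).
  + apply (n_f_cont N); [lra | apply below_alpha1; lra].
  + apply (continuous_comp (fun s => p1 s * p2 s) Rinv).
    * eapply continuous_of_derive; derive; reflexivity.
    * apply continuous_Rinv; nra.
- intros z Hz.
  assert (P1 := p_p_pos U1 z ltac:(lra)); assert (P2 := p_p_pos U2 z ltac:(lra)).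
  assert (R1 := p_r_pos U1 z ltac:(lra)).
  assert (Hh : dq (r2 z) / q (r2 z) <= dq (r1 z) / q (r1 z)).
  { destruct (Hr z ltac:(lra)) as [Hlt | ->]; [left; apply (w_log_decr W); lra | lra]. }
  replace (f z * / (p1 z * p2 z) * (p2 z - p1 z)) with (f z / p1 z - f z / p2 z)
    by (field; lra).
  lra.
- destruct (Hst y ltac:(lra)); lra.
Qed.

(** Without a crossing p2 - p1 would be positive and nonincreasing in s on (0, b), where f <= 0;
    but p2 comes arbitrarily close to 0. *)
Lemma solutions_cross : exists sI, 0 < sI < alpha1 /\ r1 sI = r2 sI /\
  forall s, sI < s < alpha1 -> r1 s < r2 s.
Proof.
destruct ordered_near_start as [s1 [Hs1 Hst]].
destruct (Classical_Prop.classic (exists x, 0 < x < alpha1 /\ r2 x <= r1 x))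
  as [[x [Hx Hrx]] | Hno].
- assert (Hxs : x <= s1).
  { destruct (Rle_dec x s1); [assumption|]; destruct (Hst x ltac:(lra)); lra. }
  set (y := (s1 + alpha1) / 2).
  assert (Hy : s1 < y < alpha1) by (unfold y; lra).
  destruct (last_zero (fun s => r1 s - r2 s) x y) as [sI [HsI [Hz Hneg]]].
  + lra.
  + intros z Hz; assert (G1 := p_dr U1 z ltac:(lra)); assert (G2 := p_dr U2 z ltac:(lra)).
    eapply continuous_of_derive; derive; reflexivity.
  + lra.
  + destruct (Hst y ltac:(lra)); lra.
  + exists sI; split; [lra|]; split; [lra|].
    intros s Hs; destruct (Rle_dec s y).
    * specialize (Hneg s ltac:(lra)); simpl in Hneg; lra.
    * apply Hst; lra.
- exfalso.
  assert (Hr : forall s, 0 < s < alpha1 -> r1 s < r2 s).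
  { intros s Hs; apply Rnot_le_lt; intros Hle; apply Hno; exists s; split; assumption. }
  assert (Hp : forall s, 0 < s < alpha1 -> p1 s < p2 s).
  { intros s Hs; apply slopes_ordered; [exact Hs|]; intros t Ht; left; apply Hr; lra. }
  assert (Hgap := Hp (b / 2) ltac:(lra)).
  destruct (slope_end W N Hbeta2 U2
    (p2 (b / 2) - p1 (b / 2)) (b / 2)) as [s [Hs [_ Hps]]]; [lra | lra |].
  assert (P1 := p_p_pos U1 s ltac:(lra)).
  enough (p2 (b / 2) - p1 (b / 2) <= p2 s - p1 s) by lra.
  apply (nonincr_of_derive (fun s => p2 s - p1 s)
    (fun s => (dq (r2 s) / q (r2 s) - f s / p2 s) - (dq (r1 s) / q (r1 s) - f s / p1 s))).
  + lra.
  + intros z Hz; assert (G1 := p_dp U1 z ltac:(lra)); assert (G2 := p_dp U2 z ltac:(lra)).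
    derive; reflexivity.
  + intros z Hz.
    assert (Q1 := p_p_pos U1 z ltac:(lra)); assert (Q2 := p_p_pos U2 z ltac:(lra)).
    assert (Hh := w_log_decr W _ _ (p_r_pos U1 z ltac:(lra)) (Hr z ltac:(lra))).
    assert (Hfz := n_f_nonpos N z ltac:(lra)).
    assert (Hi := Rinv_lt_contravar (p1 z) (p2 z) ltac:(nra) (Hp z ltac:(lra))).
    unfold Rdiv in *; nra.
Qed.

Section AfterCrossing.
Context (sI : R) (HsI : 0 < sI < alpha1) (Hcross : r1 sI = r2 sI).
Context (Hbefore : forall s, sI < s < alpha1 -> r1 s < r2 s).

Lemma slopes_ordered_before s : sI <= s < alpha1 -> p1 s < p2 s.
Proof.
intros Hs; apply slopes_ordered; [lra|]; intros t Ht.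
destruct (Req_dec t sI) as [-> | Hne]; [lra | left; apply Hbefore; lra].
Qed.

Lemma radii_gap x y : 0 < x -> x <= y -> y <= sI ->
  (forall s, x <= s <= y -> p1 s <= p2 s) -> r1 y - r2 y <= r1 x - r2 x.
Proof.
intros Hx Hxy Hy Hp.
apply (nonincr_of_derive (fun s => r1 s - r2 s) (fun s => - / p1 s - - / p2 s)); [exact Hxy | |].
- intros z Hz; assert (G1 := p_dr U1 z ltac:(lra)); assert (G2 := p_dr U2 z ltac:(lra)).
  derive; reflexivity.
- intros z Hz.
  assert (/ p2 z <= / p1 z); [|lra].
  apply Rinv_le_contravar; [apply (p_p_pos U1); lra | apply Hp; lra].
Qed.

Lemma radii_ordered x : 0 < x -> (forall s, x <= s <= sI -> p1 s <= p2 s) ->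
  forall s, x <= s <= sI -> r2 s <= r1 s.
Proof.
intros Hx Hp s Hs.
assert (r1 sI - r2 sI <= r1 s - r2 s); [|lra].
apply radii_gap; try lra; intros t Ht; apply Hp; lra.
Qed.

(** In (P1 - P2)' the constant part Hinf of K is multiplied by the difference of the fluxes. The
    excess K - Hinf is handled by the monotonicity of q (K - Hinf) where r1 <= r2, and by the
    monotonicity of K where r2 <= r1. *)
Lemma pohozaev_ordered s0 : beta < s0 -> s0 <= sI ->
  (forall s, s0 <= s <= sI -> flux1 s <= flux2 s /\ r2 s <= r1 s) ->
  pohozaev1 s0 <= pohozaev2 s0.
Proof.
intros Hs0 Hs0I Hfl.
apply le_epsilon; intros e He.
destruct (pohozaev_start W N Hbeta Hc1 U1 e He)
  as [s1 [Hs1 Hst]].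
set (y := (Rmax sI s1 + alpha1) / 2).
assert (Hm1 := Rmax_l sI s1); assert (Hm2 := Rmax_r sI s1).
assert (Hm3 : Rmax sI s1 < alpha1) by (apply Rmax_lub_lt; lra).
assert (Hy : Rmax sI s1 < y < alpha1) by (unfold y; lra).
assert (Hmon : pohozaev1 s0 - pohozaev2 s0 <= pohozaev1 y - pohozaev2 y).
{ apply (nondecr_of_derive (fun s => pohozaev1 s - pohozaev2 s)
    (fun s => flux1 s * (1 - 2 * K (r1 s) - 2 * dG s)
            - flux2 s * (1 - 2 * K (r2 s) - 2 * dG s))); [lra | |].
  - intros z Hz.
    assert (G1 := is_derive_pohozaev W N Hc1 U1 z ltac:(lra)).
    assert (G2 := is_derive_pohozaev W N Hc U2 z ltac:(lra)).
    derive; reflexivity.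
  - intros z Hz.
    assert (Hg := n_dG_lower N z ltac:(lra) (below_alpha1 z ltac:(lra))).
    assert (R1 := p_r_pos U1 z ltac:(lra)); assert (R2 := p_r_pos U2 z ltac:(lra)).
    assert (P1 := p_p_pos U1 z ltac:(lra)); assert (P2 := p_p_pos U2 z ltac:(lra)).
    assert (K1 := w_K_lower W _ R1); assert (K2 := w_K_lower W _ R2).
    assert (Q1 := w_q_pos W _ R1); assert (Q2 := w_q_pos W _ R2).
    assert (Hord : flux1 z <= flux2 z /\
      flux1 z * (K (r1 z) - Hinf) <= flux2 z * (K (r2 z) - Hinf)).
    { destruct (Rle_dec z sI) as [HzI | HzI].
      - destruct (Hfl z ltac:(lra)) as [Hf Hr]; split; [exact Hf|].
        assert (Hk := w_K_nonincr W _ _ R2 Hr).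
        apply Rmult_le_compat; try lra.
        left; apply Rmult_lt_0_compat; assumption.
      - assert (Hr := Hbefore z ltac:(lra)).
        assert (Hp := slopes_ordered_before z ltac:(lra)).
        assert (Hq := q_nondecr W _ _ R1 (Rlt_le _ _ Hr)).
        assert (Hx := w_excess_nondecr W _ _ R1 (Rlt_le _ _ Hr)).
        unfold flux; split; [apply Rmult_le_compat; lra|].
        replace (q (r1 z) * p1 z * (K (r1 z) - Hinf)) with
          (q (r1 z) * (K (r1 z) - Hinf) * p1 z) by ring.
        replace (q (r2 z) * p2 z * (K (r2 z) - Hinf)) with
          (q (r2 z) * (K (r2 z) - Hinf) * p2 z) by ring.
        apply Rmult_le_compat; try lra; apply Rmult_le_pos; lra. }
    destruct Hord as [Hord1 Hord2].
    assert (0 <= (flux2 z - flux1 z) * (dG z - (/ 2 - Hinf))) by (apply Rmult_le_pos; lra).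
    lra. }
assert (HP2 := pohozaev_nonneg W N Hbeta2 Hc U2 y ltac:(lra)).
specialize (Hst y ltac:(lra)); lra.
Qed.

Lemma inv_sqr_ordered z : 0 < z < alpha1 -> p1 z <= p2 z -> / p2 z ^ 2 <= / p1 z ^ 2.
Proof.
intros Hz Hp; assert (P1 := p_p_pos U1 z Hz).
apply Rinv_le_contravar; [nra | apply pow_incr; lra].
Qed.

(** Going down from sI the difference of the fluxes can change sign once, at s0. There the
    Pohozaev functions are ordered, and with equal fluxes this orders the energy ratios. Below s0
    the integrating factor flux1 removes from (Y1 - Y2)' the term f (Y1 - Y2) / p1^2, and what
    remains has a sign by [energy_ratio_lower]. *)
Lemma compare_above x : beta <= x -> x <= sI -> (forall s, x <= s <= sI -> p1 s <= p2 s) ->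
  flux1 x <= flux2 x \/ energy_ratio1 x <= energy_ratio2 x.
Proof.
intros Hx HxI Hp.
destruct (Rle_dec (flux1 x) (flux2 x)) as [|Hflx]; [left; assumption | right].
assert (Hr := radii_ordered x ltac:(lra) Hp).
assert (Hd : forall z, x <= z <= sI -> is_derive (fun s => flux2 s - flux1 s) z
  (- q (r2 z) * f z / p2 z - - q (r1 z) * f z / p1 z)).
{ intros z Hz.
  assert (G1 := is_derive_flux W U1 z ltac:(lra)).
  assert (G2 := is_derive_flux W U2 z ltac:(lra)).
  derive; reflexivity. }
assert (Hmon : forall s t, x <= s -> s <= t -> t <= sI -> flux2 s - flux1 s <= flux2 t - flux1 t).
{ intros s t Hs Hst Ht.
  apply (nondecr_of_derive (fun s => flux2 s - flux1 s) (fun z =>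
    - q (r2 z) * f z / p2 z - - q (r1 z) * f z / p1 z)); [exact Hst | |].
  - intros z Hz; apply Hd; lra.
  - intros z Hz.
    assert (R1 := p_r_pos U1 z ltac:(lra)); assert (R2 := p_r_pos U2 z ltac:(lra)).
    assert (P1 := p_p_pos U1 z ltac:(lra)).
    assert (Hi : / p2 z <= / p1 z) by (apply Rinv_le_contravar; [lra | apply Hp; lra]).
    assert (Hi2 : 0 < / p2 z) by (apply Rinv_0_lt_compat, (p_p_pos U2); lra).
    assert (Hq := q_nondecr W _ _ R2 (Hr z ltac:(lra))).
    assert (Hq2 := w_q_pos W _ R2).
    assert (Hf := n_f_pos N z ltac:(lra) (below_alpha1 z ltac:(lra))).
    assert (Hm : q (r2 z) * / p2 z <= q (r1 z) * / p1 z) by (apply Rmult_le_compat; lra).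
    unfold Rdiv; nra. }
assert (HflI : flux1 sI < flux2 sI).
{ unfold flux; rewrite Hcross; apply Rmult_lt_compat_l;
    [apply (w_q_pos W), (p_r_pos U2); lra | apply slopes_ordered_before; lra]. }
destruct (first_zero (fun s => flux2 s - flux1 s) x sI) as [s0 [Hs0 [Hz0 _]]];
  [lra | | lra | lra |].
{ intros z Hz; exact (continuous_of_derive _ _ _ (Hd z Hz)). }
assert (HP : pohozaev1 s0 <= pohozaev2 s0).
{ apply pohozaev_ordered; [lra | lra |]; intros s Hs; split; [|apply Hr; lra].
  assert (Hm := Hmon s0 s ltac:(lra) ltac:(lra) ltac:(lra)); lra. }
assert (HY0 : energy_ratio1 s0 <= energy_ratio2 s0).
{ assert (P1 := p_p_pos U1 s0 ltac:(lra)); assert (P2 := p_p_pos U2 s0 ltac:(lra)).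
  assert (Q1 := w_q_pos W _ (p_r_pos U1 s0 ltac:(lra))).
  assert (Q2 := w_q_pos W _ (p_r_pos U2 s0 ltac:(lra))).
  assert (Hfl := flux_pos W U1 s0 ltac:(lra)).
  assert (E1 : 2 * flux1 s0 * energy_ratio1 s0 = Q (r1 s0) * (p1 s0 ^ 2 + 2 * F s0)).
  { unfold flux, energy_ratio; field; lra. }
  assert (E2 : 2 * flux2 s0 * energy_ratio2 s0 = Q (r2 s0) * (p2 s0 ^ 2 + 2 * F s0)).
  { unfold flux, energy_ratio; field; lra. }
  unfold pohozaev in HP; rewrite <- E1, <- E2 in HP.
  replace (flux2 s0) with (flux1 s0) in HP by lra.
  nra. }
assert (Hend : flux1 x * (energy_ratio1 x - energy_ratio2 x) <=
  flux1 s0 * (energy_ratio1 s0 - energy_ratio2 s0)).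
{ apply (nondecr_of_derive (fun s => flux1 s * (energy_ratio1 s - energy_ratio2 s))
    (fun s => flux1 s * (K (r2 s) - K (r1 s)
       + (energy_ratio2 s * f s - F s) * (/ p1 s ^ 2 - / p2 s ^ 2)))); [lra | |].
  - intros z Hz.
    assert (P1 := p_p_pos U1 z ltac:(lra)); assert (P2 := p_p_pos U2 z ltac:(lra)).
    assert (G1 := is_derive_flux W U1 z ltac:(lra)).
    assert (G2 := is_derive_energy_ratio W N Hc1 U1 z ltac:(lra)).
    assert (G3 := is_derive_energy_ratio W N Hc U2 z ltac:(lra)).
    derive.
    replace (- q (r1 z) * f z / p1 z) with (- flux1 z * f z / p1 z ^ 2)
      by (unfold flux; field; lra).
    field; lra.
  - intros z Hz.
    assert (Hfl := flux_pos W U1 z ltac:(lra)).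
    apply Rmult_le_pos; [lra|].
    assert (Hk := w_K_nonincr W _ _ (p_r_pos U2 z ltac:(lra)) (Hr z ltac:(lra))).
    assert (Hy := energy_ratio_lower W N Hbeta2 Hc U2 z ltac:(lra)).
    assert (Hi := inv_sqr_ordered z ltac:(lra) (Hp z ltac:(lra))).
    assert (0 <= (energy_ratio2 z * f z - F z) * (/ p1 z ^ 2 - / p2 z ^ 2))
      by (apply Rmult_le_pos; lra).
    lra. }
assert (Hfx := flux_pos W U1 x ltac:(lra)).
assert (Hf0 := flux_pos W U1 s0 ltac:(lra)).
nra.
Qed.

(** With F <= 0 the quotient p / sqrt (p^2 + 2 F) is at least 1 and decreases in p. *)
Lemma speed_quotient_ordered z : 0 < z <= beta -> z < alpha1 -> p1 z <= p2 z ->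
  p2 z / sqrt (p2 z ^ 2 + 2 * F z) <= p1 z / sqrt (p1 z ^ 2 + 2 * F z).
Proof.
intros Hz Hza Hp.
assert (P1 := p_p_pos U1 z ltac:(lra)); assert (P2 := p_p_pos U2 z ltac:(lra)).
assert (E1 := p_energy U1 z ltac:(lra)); assert (E2 := p_energy U2 z ltac:(lra)).
assert (HF := F_nonpos N z ltac:(lra)).
assert (W1 := sqrt_lt_R0 _ E1); assert (W2 := sqrt_lt_R0 _ E2).
assert (S1 := pow2_sqrt _ (Rlt_le _ _ E1)); assert (S2 := pow2_sqrt _ (Rlt_le _ _ E2)).
set (w1 := sqrt (p1 z ^ 2 + 2 * F z)) in *; set (w2 := sqrt (p2 z ^ 2 + 2 * F z)) in *.
apply Rle_div_l; [exact W2|].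
replace (p1 z / w1 * w2) with ((p1 z * w2) / w1) by (field; lra).
apply Rle_div_r; [exact W1|].
apply Rsqr_incr_0_var; [|apply Rmult_le_pos; lra].
unfold Rsqr.
replace (p2 z * w1 * (p2 z * w1)) with (p2 z ^ 2 * w1 ^ 2) by ring.
replace (p1 z * w2 * (p1 z * w2)) with (p1 z ^ 2 * w2 ^ 2) by ring.
rewrite S1, S2.
assert (p1 z ^ 2 <= p2 z ^ 2) by (apply pow_incr; lra).
nra.
Qed.

Lemma speed_quotient_ordered_strict z : b <= z < beta -> p1 z < p2 z ->
  p2 z / sqrt (p2 z ^ 2 + 2 * F z) < p1 z / sqrt (p1 z ^ 2 + 2 * F z).
Proof.
intros Hz Hp.
destruct (Rle_lt_or_eq_dec _ _ (speed_quotient_ordered z ltac:(lra) ltac:(lra) (Rlt_le _ _ Hp)))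
  as [|He]; [assumption | exfalso].
assert (P1 := p_p_pos U1 z ltac:(lra)); assert (P2 := p_p_pos U2 z ltac:(lra)).
assert (E1 := p_energy U1 z ltac:(lra)); assert (E2 := p_energy U2 z ltac:(lra)).
assert (HF := F_neg N z Hz).
assert (W1 := sqrt_lt_R0 _ E1); assert (W2 := sqrt_lt_R0 _ E2).
assert (S1 := pow2_sqrt _ (Rlt_le _ _ E1)); assert (S2 := pow2_sqrt _ (Rlt_le _ _ E2)).
set (w1 := sqrt (p1 z ^ 2 + 2 * F z)) in *; set (w2 := sqrt (p2 z ^ 2 + 2 * F z)) in *.
assert (Hx : p2 z * w1 = p1 z * w2).
{ replace (p2 z) with (p2 z / w2 * w2) by (field; lra); rewrite He; field; lra. }
assert (Hx2 : p2 z ^ 2 * w1 ^ 2 = p1 z ^ 2 * w2 ^ 2) by (rewrite <- !Rpow_mult_distr, Hx; ring).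
rewrite S1, S2 in Hx2.
assert (F z * (p2 z - p1 z) * (p2 z + p1 z) = 0) by nra.
assert (0 < (p2 z - p1 z) * (p2 z + p1 z)) by (apply Rmult_lt_0_compat; lra).
nra.
Qed.

Lemma is_derive_speed_gap z : 0 < z < alpha1 ->
  is_derive (fun s => scaled_speed1 s - scaled_speed2 s) z
   (((1 - K (r1 z)) * (p1 z / sqrt (p1 z ^ 2 + 2 * F z))
     - K (r1 z) * (sqrt (p1 z ^ 2 + 2 * F z) / p1 z))
    - ((1 - K (r2 z)) * (p2 z / sqrt (p2 z ^ 2 + 2 * F z))
     - K (r2 z) * (sqrt (p2 z ^ 2 + 2 * F z) / p2 z))).
Proof.
intros Hz.
assert (G1 := is_derive_scaled_speed W N Hc1 U1 z Hz).
assert (G2 := is_derive_scaled_speed W N Hc U2 z ltac:(lra)).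
derive; reflexivity.
Qed.

(** The derivative (1 - K) t - K / t of the scaled speed, with t = p / sqrt (p^2 + 2 F),
    increases in t and decreases in K. *)
Lemma speed_rate_ordered k1 k2 x1 x2 w1 w2 :
  0 < x1 -> 0 < x2 -> 0 < w1 -> 0 < w2 -> 0 < k1 -> k1 <= k2 -> k2 < 1 ->
  x2 / w2 <= x1 / w1 ->
  (1 - k2) * (x1 / w1 - x2 / w2) <=
    ((1 - k1) * (x1 / w1) - k1 * (w1 / x1)) - ((1 - k2) * (x2 / w2) - k2 * (w2 / x2)).
Proof.
intros X1 X2 W1 W2 K1 Hk K2 Hx.
assert (T1 : 0 < x1 / w1) by (apply Rdiv_lt_0_compat; assumption).
assert (T2 : 0 < x2 / w2) by (apply Rdiv_lt_0_compat; assumption).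
assert (Hi : / (x1 / w1) <= / (x2 / w2)) by (apply Rinv_le_contravar; assumption).
replace (w1 / x1) with (/ (x1 / w1)) by (field; lra).
replace (w2 / x2) with (/ (x2 / w2)) by (field; lra).
assert (I1 : 0 < / (x1 / w1)) by (apply Rinv_0_lt_compat; assumption).
assert (k1 * / (x1 / w1) <= k2 * / (x2 / w2)) by (apply Rmult_le_compat; lra).
nra.
Qed.

Lemma speed_gap_nondecr x y : 0 < x -> x <= y -> y <= beta -> y < alpha1 ->
  (forall s, x <= s <= y -> p1 s <= p2 s /\ r2 s <= r1 s) ->
  scaled_speed1 x - scaled_speed2 x <= scaled_speed1 y - scaled_speed2 y.
Proof.
intros Hx Hxy Hy Hya Hord.
eapply (nondecr_of_derive (fun s => scaled_speed1 s - scaled_speed2 s)); [exact Hxy | |].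
- intros z Hz; apply is_derive_speed_gap; lra.
- intros z Hz; destruct (Hord z ltac:(lra)) as [Hp Hr].
  assert (R1 := p_r_pos U1 z ltac:(lra)); assert (R2 := p_r_pos U2 z ltac:(lra)).
  assert (Hq := speed_quotient_ordered z ltac:(lra) ltac:(lra) Hp).
  assert (Hk := K_lt_half W _ R2).
  eapply Rle_trans; [|apply speed_rate_ordered; try exact Hq].
  + apply Rmult_le_pos; lra.
  + apply (p_p_pos U1); lra.
  + apply (p_p_pos U2); lra.
  + apply sqrt_lt_R0, (p_energy U1); lra.
  + apply sqrt_lt_R0, (p_energy U2); lra.
  + apply (K_pos W), R1.
  + apply (w_K_nonincr W); assumption.
  + lra.
Qed.

Lemma speed_gap_incr x : b <= x < beta -> beta <= sI ->
  (forall s, x <= s <= beta -> p1 s < p2 s /\ r2 s <= r1 s) ->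
  scaled_speed1 x - scaled_speed2 x < scaled_speed1 beta - scaled_speed2 beta.
Proof.
intros Hx HsIb Hord.
eapply (incr_of_derive (fun s => scaled_speed1 s - scaled_speed2 s)); [lra | |].
- intros z Hz; apply is_derive_speed_gap; lra.
- intros z Hz; destruct (Hord z ltac:(lra)) as [Hp Hr].
  assert (R1 := p_r_pos U1 z ltac:(lra)); assert (R2 := p_r_pos U2 z ltac:(lra)).
  assert (Hq := speed_quotient_ordered_strict z ltac:(lra) Hp).
  assert (Hk := K_lt_half W _ R2).
  eapply Rlt_le_trans; [|apply speed_rate_ordered; try exact (Rlt_le _ _ Hq)].
  + apply Rmult_lt_0_compat; lra.
  + apply (p_p_pos U1); lra.
  + apply (p_p_pos U2); lra.
  + apply sqrt_lt_R0, (p_energy U1); lra.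
  + apply sqrt_lt_R0, (p_energy U2); lra.
  + apply (K_pos W), R1.
  + apply (w_K_nonincr W); assumption.
  + lra.
Qed.

(** At beta, where F = 0, the scaled speed is (Q / q^2) times the flux and also twice the energy
    ratio. *)
Lemma compare_at_beta : beta <= sI -> (forall s, beta <= s <= sI -> p1 s <= p2 s) ->
  scaled_speed1 beta <= scaled_speed2 beta.
Proof.
intros HbI Hp.
assert (Hr := radii_ordered beta ltac:(lra) Hp beta ltac:(lra)).
assert (R1 := p_r_pos U1 beta ltac:(lra)); assert (R2 := p_r_pos U2 beta ltac:(lra)).
assert (P1 := p_p_pos U1 beta ltac:(lra)); assert (P2 := p_p_pos U2 beta ltac:(lra)).
assert (Q1 := w_q_pos W _ R1); assert (Q2 := w_q_pos W _ R2).
assert (A1 := ratio_pos W _ R1).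
unfold scaled_speed; rewrite (n_F_beta N), !Rmult_0_r, !Rplus_0_r, !sqrt_pow2 by lra.
destruct (compare_above beta (Rle_refl _) HbI Hp) as [Hfl | HY].
- assert (Hg := ratio2_nonincr W _ _ R2 Hr).
  assert (0 < Q (r1 beta) / q (r1 beta) / q (r1 beta)) by (apply Rdiv_lt_0_compat; assumption).
  replace (Q (r1 beta) / q (r1 beta) * p1 beta) with
    (Q (r1 beta) / q (r1 beta) / q (r1 beta) * flux1 beta) by (unfold flux; field; lra).
  replace (Q (r2 beta) / q (r2 beta) * p2 beta) with
    (Q (r2 beta) / q (r2 beta) / q (r2 beta) * flux2 beta) by (unfold flux; field; lra).
  apply Rmult_le_compat; try lra.
  left; apply Rmult_lt_0_compat; assumption.
- unfold energy_ratio in HY; rewrite (n_F_beta N), !Rplus_0_r in HY.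
  replace (Q (r1 beta) / q (r1 beta) * p1 beta) with
    (2 * (Q (r1 beta) / q (r1 beta) * (p1 beta ^ 2 / 2) / p1 beta)) by (field; lra).
  replace (Q (r2 beta) / q (r2 beta) * p2 beta) with
    (2 * (Q (r2 beta) / q (r2 beta) * (p2 beta ^ 2 / 2) / p2 beta)) by (field; lra).
  lra.
Qed.

Lemma compare_at_crossing : scaled_speed1 sI < scaled_speed2 sI.
Proof.
assert (R2 := p_r_pos U2 sI ltac:(lra)); assert (P1 := p_p_pos U1 sI HsI).
assert (E1 := p_energy U1 sI HsI).
unfold scaled_speed; rewrite Hcross; apply Rmult_lt_compat_l.
- apply (ratio_pos W), R2.
- apply sqrt_lt_1_alt; assert (Hp := slopes_ordered_before sI ltac:(lra)); nra.
Qed.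

Lemma compare_below x : 0 < x -> x <= beta -> x <= sI ->
  (forall s, x <= s <= sI -> p1 s <= p2 s) -> scaled_speed1 x <= scaled_speed2 x.
Proof.
intros Hx Hxb HxI Hp.
assert (Hr := radii_ordered x Hx Hp).
destruct (Rle_dec beta sI) as [HbI | HbI].
- assert (Hend := compare_at_beta HbI ltac:(intros s Hs; apply Hp; lra)).
  assert (Hg := speed_gap_nondecr x beta Hx Hxb ltac:(lra) ltac:(lra)
    ltac:(intros s Hs; split; [apply Hp | apply Hr]; lra)).
  lra.
- assert (Hend := compare_at_crossing).
  assert (Hg := speed_gap_nondecr x sI Hx HxI ltac:(lra) ltac:(lra)
    ltac:(intros s Hs; split; [apply Hp | apply Hr]; lra)).
  lra.
Qed.

(** Where the slopes agreed again, the first solution would be strictly larger in each of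
    the compared quantities, because r2 < r1 there. *)
Lemma slopes_ordered_after x : 0 < x <= sI -> p1 x < p2 x.
Proof.
intros Hx; apply Rnot_le_lt; intros Hle.
destruct (last_zero (fun s => p1 s - p2 s) x sI) as [s [Hs [Hz Hneg]]].
- lra.
- intros z Hz; assert (G1 := p_dp U1 z ltac:(lra)); assert (G2 := p_dp U2 z ltac:(lra)).
  eapply continuous_of_derive; derive; reflexivity.
- lra.
- assert (Hp := slopes_ordered_before sI ltac:(lra)); lra.
- assert (Hp : forall t, s <= t <= sI -> p1 t <= p2 t).
  { intros t Ht; destruct (Req_dec t s) as [-> |]; [lra|].
    specialize (Hneg t ltac:(lra)); simpl in Hneg; lra. }
  assert (Hr : r2 s < r1 s).
  { assert (Hgap : r1 sI - r2 sI < r1 s - r2 s); [|lra].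
    apply (decr_of_derive (fun s => r1 s - r2 s) (fun s => - / p1 s - - / p2 s)); [lra | |].
    - intros z Hz'; assert (G1 := p_dr U1 z ltac:(lra)); assert (G2 := p_dr U2 z ltac:(lra)).
      derive; reflexivity.
    - intros z Hz'; specialize (Hneg z ltac:(lra)); simpl in Hneg.
      assert (P1 := p_p_pos U1 z ltac:(lra)); assert (P2 := p_p_pos U2 z ltac:(lra)).
      assert (Hi := Rinv_lt_contravar (p1 z) (p2 z) ltac:(nra) ltac:(lra)); lra. }
  assert (R1 := p_r_pos U1 s ltac:(lra)); assert (R2 := p_r_pos U2 s ltac:(lra)).
  assert (P2 := p_p_pos U2 s ltac:(lra)); assert (E2 := p_energy U2 s ltac:(lra)).
  assert (HA := ratio_incr W _ _ R2 Hr).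
  assert (Hpe : p1 s = p2 s) by lra.
  destruct (Rle_dec beta s) as [Hbs | Hbs].
  + destruct (compare_above s Hbs ltac:(lra) Hp) as [Hfl | HY].
    * unfold flux in Hfl; rewrite Hpe in Hfl.
      assert (Hq := q_incr W _ _ R2 Hr); nra.
    * unfold energy_ratio in HY; rewrite Hpe in HY.
      assert (HE : 0 < (p2 s ^ 2 / 2 + F s) / p2 s) by (apply Rdiv_lt_0_compat; lra).
      unfold Rdiv in HY; rewrite !(Rmult_assoc (Q _ * / q _)) in HY.
      unfold Rdiv in HE, HA; nra.
  + assert (HW := compare_below s ltac:(lra) ltac:(lra) ltac:(lra) Hp).
    unfold scaled_speed in HW; rewrite Hpe in HW.
    assert (Hw := sqrt_lt_R0 _ E2); nra.
Qed.

(** A strict gap at x0 comes from p1 < p2 at the crossing if sI < beta, and from F < 0 on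
    (b, beta) otherwise. *)
Lemma crossing_impossible : False.
Proof.
assert (Hp : forall s, 0 < s <= sI -> p1 s < p2 s) by exact slopes_ordered_after.
assert (Hr : forall s, 0 < s <= sI -> r2 s <= r1 s).
{ intros s Hs; apply (radii_ordered s); [lra | | lra].
  intros t Ht; left; apply Hp; lra. }
assert (Hx0 : exists x0, 0 < x0 <= sI /\ x0 <= beta /\ scaled_speed1 x0 < scaled_speed2 x0).
{ destruct (Rle_dec beta sI) as [HbI | HbI].
  - exists b; split; [lra|]; split; [lra|].
    assert (H1 := compare_at_beta HbI ltac:(intros s Hs; left; apply Hp; lra)).
    assert (H2 := speed_gap_incr b ltac:(lra) HbI
      ltac:(intros s Hs; split; [apply Hp | apply Hr]; lra)).
    lra.
  - exists sI; split; [lra|]; split; [lra|]; exact compare_at_crossing. }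
destruct Hx0 as [x0 [Hx0 [Hx0b Hgap]]].
destruct (p_end U2 (scaled_speed2 x0 - scaled_speed1 x0) x0) as [s [Hs [_ Hsmall]]]; [lra | lra |].
assert (Hg := speed_gap_nondecr s x0 ltac:(lra) ltac:(lra) Hx0b ltac:(lra)
  ltac:(intros t Ht; split; [left; apply Hp | apply Hr]; lra)).
assert (0 < scaled_speed1 s).
{ apply Rmult_lt_0_compat; [apply (ratio_pos W), (p_r_pos U1); lra|].
  apply sqrt_lt_R0, (p_energy U1); lra. }
change (scaled_speed2 s < scaled_speed2 x0 - scaled_speed1 x0) in Hsmall.
lra.
Qed.

End AfterCrossing.

Lemma heights_not_ordered : False.
Proof.
destruct solutions_cross as [sI [HsI [Hcross Hbefore]]].
exact (crossing_impossible sI HsI Hcross Hbefore).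
Qed.

End Comparison.

(** * Nonnegative solutions decrease until they vanish *)

(** The behaviour at 0 is recorded as one-sided limits, so that derivatives are needed only on
    (0, oo). *)
Record ground_state (c : Rbar) (q dq f u du : R -> R) : Prop := {
  g_range : forall r, 0 <= r -> Rbar_lt (u r) c;
  g_nonneg : forall r, 0 <= r -> 0 <= u r;
  g_height : 0 < u 0;
  g_start : forall e, 0 < e -> exists d, 0 < d /\
    forall r, 0 < r < d -> Rabs (u r - u 0) < e /\ Rabs (du r) < e;
  g_du : forall r, 0 < r -> is_derive u r (du r);
  g_ddu : forall r, 0 < r -> is_derive du r (- f (u r) - dq r / q r * du r);
  g_end : forall e, 0 < e -> exists M, forall r, M < r -> u r < e }.

Arguments g_range {c q dq f u du}.
Arguments g_nonneg {c q dq f u du}.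
Arguments g_height {c q dq f u du}.
Arguments g_start {c q dq f u du}.
Arguments g_du {c q dq f u du}.
Arguments g_ddu {c q dq f u du}.
Arguments g_end {c q dq f u du}.

(** The difference quotients of [r] are the inverses of those of [u]; [quot] extends the
    latter continuously to the increment 0. *)
Lemma is_derive_inverse (u r : R -> R) (s l : R) :
  continuous r s -> locally s (fun t => u (r t) = t) -> is_derive u (r s) l -> l <> 0 ->
  is_derive r s (/ l).
Proof.
intros Hr [d0 Hur] Hu Hl.
set (quot := fun k => if Req_EM_T k 0 then l else (u (r s + k) - u (r s)) / k).
assert (Hq0 : quot 0 = l) by (unfold quot; destruct (Req_EM_T 0 0); lra).
assert (Hquot : continuous quot 0).
{ intros P [e He].
  rewrite Hq0 in He.
  destruct (proj1 (is_derive_Reals _ _ _) Hu e (cond_pos e)) as [d Hd].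
  exists d; intros k Hk; apply He.
  unfold quot; destruct (Req_EM_T k 0) as [|Hk0]; [apply ball_center|].
  apply Hd; [exact Hk0|].
  revert Hk; unfold ball; simpl; unfold AbsRing_ball, abs, minus, plus, opp; simpl.
  rewrite Ropp_0, Rplus_0_r; auto. }
assert (Hcomp : continuous (fun h => / quot (r (s + h) - r s)) 0).
{ apply (continuous_comp (fun h => quot (r (s + h) - r s)) Rinv).
  - apply (continuous_comp (fun h => r (s + h) - r s) quot).
    + apply (continuous_minus (fun h => r (s + h)) (fun _ => r s)); [|apply continuous_const].
      apply (continuous_comp (fun h => s + h) r).
      * apply (continuous_plus (fun _ => s) (fun h => h)); [apply continuous_const|].
        apply continuous_id.
      * rewrite Rplus_0_r; exact Hr.
    + rewrite Rplus_0_r, Rminus_diag; exact Hquot.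
  - rewrite Rplus_0_r, Rminus_diag, Hq0; apply continuous_Rinv, Hl. }
apply is_derive_Reals; intros e He.
destruct (Hcomp (fun y => Rabs (y - / l) < e)) as [d Hd].
{ exists (mkposreal e He); intros y Hy.
  rewrite Rplus_0_r, Rminus_diag, Hq0 in Hy; exact Hy. }
assert (Hm : 0 < Rmin d0 d) by (apply Rmin_case; apply cond_pos).
exists (mkposreal _ Hm); simpl; intros h Hh0 Hh.
assert (Hh1 := Rmin_l d0 d); assert (Hh2 := Rmin_r d0 d).
specialize (Hd h).
assert (Hball : ball 0 d h).
{ unfold ball; simpl; unfold AbsRing_ball, abs, minus, plus, opp; simpl.
  rewrite Ropp_0, Rplus_0_r; lra. }
specialize (Hd Hball).
assert (Hs : u (r s) = s) by (apply Hur, ball_center).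
assert (Hsh : u (r (s + h)) = s + h).
{ apply Hur; unfold ball; simpl; unfold AbsRing_ball, abs, minus, plus, opp; simpl.
  replace (s + h + - s) with h by ring; lra. }
revert Hd; unfold quot.
destruct (Req_EM_T (r (s + h) - r s) 0) as [Hz | Hz]; intros Hd.
- exfalso; apply Hh0.
  assert (Heq : r (s + h) = r s) by lra; rewrite Heq in Hsh; lra.
- replace (r s + (r (s + h) - r s)) with (r (s + h)) in Hd by ring.
  rewrite Hs, Hsh in Hd.
  replace ((r (s + h) - r s) / h) with (/ ((s + h - s) / (r (s + h) - r s))); [exact Hd|].
  field; repeat split; lra.
Qed.

Section GroundState.
Context {q dq Q K : R -> R} {H0 Hinf : R} (W : weight q dq Q K H0 Hinf).
Context {c : Rbar} {f F dG : R -> R} {b beta : R}.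
Context (N : nonlinearity c f F dG b beta Hinf).
Context {u du : R -> R} (G : ground_state c q dq f u du).

Let Hb : 0 < b := n_b_pos N.
Let Hbb : b < beta := n_b_beta N.

Definition energy r := du r ^ 2 / 2 + F (u r).

Lemma is_derive_F_u r : 0 < r -> is_derive (fun t => F (u t)) r (f (u r) * du r).
Proof.
intros Hr; eapply is_derive_eq.
- apply is_derive_comp_R; [|apply (g_du G), Hr].
  apply (n_dF N); [apply (g_nonneg G) | apply (g_range G)]; lra.
- ring.
Qed.

Lemma is_derive_energy r : 0 < r -> is_derive energy r (- (dq r / q r * du r ^ 2)).
Proof.
intros Hr; assert (H1 := is_derive_F_u r Hr); assert (H2 := g_ddu G r Hr).
assert (Hq := w_q_pos W r Hr).
unfold energy; derive; simpl; field; lra.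
Qed.

Lemma energy_nonincr x y : 0 < x -> x <= y -> energy y <= energy x.
Proof.
intros Hx Hxy.
apply (nonincr_of_derive energy (fun r => - (dq r / q r * du r ^ 2))); [exact Hxy | |];
  intros z Hz.
- apply is_derive_energy; lra.
- assert (Hh := log_derive_pos W z ltac:(lra)).
  assert (H2 := pow2_ge_0 (du z)); nra.
Qed.

(** A negative energy would persist, but F(u) tends to 0. *)
Lemma energy_nonneg r : 0 < r -> 0 <= energy r.
Proof.
intros Hr; apply Rnot_lt_le; intros Hneg.
destruct (F_small N (- energy r)) as [d [Hd HF]]; [lra|].
destruct (g_end G d Hd) as [M HM].
set (y := Rmax r (M + 1)).
assert (Hy1 : r <= y) by apply Rmax_l.
assert (Hy2 : M + 1 <= y) by apply Rmax_r.
assert (Hmon := energy_nonincr r y Hr Hy1).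
specialize (HM y ltac:(lra)).
assert (Hu := g_nonneg G y ltac:(lra)).
assert (HFy : - F (u y) < - energy r).
{ destruct Hu as [Hu | Hu].
  - apply HF; lra.
  - rewrite <- Hu, (n_F_zero N); lra. }
unfold energy in Hmon at 1; assert (H2 := pow2_ge_0 (du y)); lra.
Qed.

(** The energy stays 0, so its derivative - (q'/q) u'^2 vanishes and u is constant. *)
Lemma vanishes_after_zero_energy x y : 0 < x -> energy x = 0 -> x <= y -> u y = 0.
Proof.
intros Hx HE Hxy.
assert (HE0 : forall r, x <= r -> energy r = 0).
{ intros r Hr; assert (H1 := energy_nonincr x r Hx Hr).
  assert (H2 := energy_nonneg r ltac:(lra)); lra. }
assert (Hdu : forall r, x < r -> du r = 0).
{ intros r Hr.
  assert (Hd := is_derive_energy r ltac:(lra)).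
  assert (Hd0 : is_derive energy r 0).
  { apply (is_derive_ext_loc (fun _ => 0)); [|apply is_derive_const_R].
    apply (filter_imp (fun t => x < t)); [|apply (open_gt x), Hr].
    intros t Ht; symmetry; apply HE0; lra. }
  apply is_derive_unique in Hd; apply is_derive_unique in Hd0.
  assert (Hh := log_derive_pos W r ltac:(lra)).
  destruct (Req_dec (du r) 0) as [|Hn]; [assumption | exfalso].
  assert (H2 := pow2_gt_0 _ Hn).
  assert (Derive energy r < 0) by (rewrite Hd; nra).
  lra. }
apply Rle_antisym; [|apply (g_nonneg G); lra].
apply le_epsilon; intros e He.
destruct (g_end G e He) as [M HM].
set (z := Rmax y (M + 1)).
assert (Hz1 : y <= z) by apply Rmax_l.
assert (Hz2 : M + 1 <= z) by apply Rmax_r.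
specialize (HM z ltac:(lra)).
enough (u y <= u z) by lra.
apply (nondecr_of_derive u du); [exact Hz1 | |]; intros t Ht.
- apply (g_du G); lra.
- rewrite Hdu; lra.
Qed.

Lemma energy_pos r : 0 < r -> 0 < u r -> 0 < energy r.
Proof.
intros Hr Hu; destruct (energy_nonneg r Hr) as [|He]; [assumption|].
assert (Hz := vanishes_after_zero_energy r r Hr (eq_sym He) (Rle_refl r)); lra.
Qed.

(** A zero of the nonnegative function [u] is a minimum. *)
Lemma energy_zero r : 0 < r -> u r = 0 -> energy r = 0.
Proof.
intros Hr Hu.
assert (Hd := proj1 (is_derive_Reals _ _ _) (g_du G r Hr)).
assert (Hdu : du r = 0).
{ rewrite <- (deriv_minimum u 0 (r + 1) r (exist _ (du r) Hd)).
  - reflexivity.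
  - exact Hr.
  - lra.
  - intros x Hx _; rewrite Hu; apply (g_nonneg G); lra. }
unfold energy; rewrite Hu, Hdu, (n_F_zero N); simpl; lra.
Qed.

Lemma zero_persists x y : 0 < x -> x <= y -> u x = 0 -> u y = 0.
Proof.
intros Hx Hxy Hu; apply (vanishes_after_zero_energy x y Hx); [|exact Hxy].
apply energy_zero; assumption.
Qed.

Lemma positive_before x y : 0 < x -> x <= y -> 0 < u y -> 0 < u x.
Proof.
intros Hx Hxy Hu; destruct (g_nonneg G x ltac:(lra)) as [|He]; [assumption|].
assert (Hz := zero_persists x y Hx Hxy (eq_sym He)); lra.
Qed.

Lemma near_height e : 0 < e -> exists x, 0 < x < e /\
  forall r, 0 < r <= x -> Rabs (u r - u 0) < e /\ Rabs (du r) < e.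
Proof.
intros He; destruct (g_start G e He) as [d [Hd Hst]].
assert (Hm : 0 < Rmin d e) by (apply Rmin_case; lra).
assert (Hm1 := Rmin_l d e); assert (Hm2 := Rmin_r d e).
exists (Rmin d e / 2); split; [lra|]; intros r Hr; apply Hst; lra.
Qed.

(** F(u(0)) is the limit of the energy at 0, hence positive. *)
Lemma height_above_beta : beta < u 0.
Proof.
assert (Hu0 := g_height G).
destruct (near_height (u 0) Hu0) as [x [Hx Hst]].
destruct (Hst x ltac:(lra)) as [Hux _]; apply Rabs_def2 in Hux.
assert (HE := energy_pos x ltac:(lra) ltac:(lra)).
apply Rnot_le_lt; intros Hle.
assert (HF0 := F_nonpos N (u 0) ltac:(lra)).
assert (HcF := continuous_of_derive _ _ _ (n_dF N (u 0) ltac:(lra) (g_range G 0 (Rle_refl 0)))).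
set (e := energy x / 2) in *.
destruct (continuous_neg_near (fun s => F s - e) (u 0)) as [d [Hd HFd]].
- apply (continuous_minus F (fun _ => e)); [exact HcF | apply continuous_const].
- unfold e; lra.
- destruct (near_height (Rmin d (Rmin 1 e))) as [y [Hy Hsty]].
  { repeat apply Rmin_case; unfold e; lra. }
  assert (Hm1 := Rmin_l d (Rmin 1 e)); assert (Hm2 := Rmin_r d (Rmin 1 e)).
  assert (Hm3 := Rmin_l 1 e); assert (Hm4 := Rmin_r 1 e).
  set (z := Rmin x y).
  assert (Hz : 0 < z) by (apply Rmin_case; lra).
  assert (Hz1 : z <= x) by apply Rmin_l; assert (Hz2 : z <= y) by apply Rmin_r.
  destruct (Hsty z ltac:(lra)) as [Huz Hduz].
  specialize (HFd (u z) ltac:(lra)); simpl in HFd.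
  assert (Hmon := energy_nonincr z x Hz Hz1).
  assert (Hdu2 : du z ^ 2 < e).
  { rewrite <- pow2_abs; assert (Hp := Rabs_pos (du z)); nra. }
  unfold energy in Hmon at 2; unfold e in *; lra.
Qed.

(** At a zero of [du] with [u] positive the energy is F(u), so F(u) > 0, [u] exceeds beta and
    q [du] is decreasing there; but q [du] starts out negative. *)
Lemma du_neg r : 0 < r -> 0 < u r -> du r < 0.
Proof.
intros Hr Hur; assert (Hh := height_above_beta).
assert (Hdm : forall z, 0 < z -> is_derive (fun t => q t * du t) z (- (q z * f (u z)))).
{ intros z Hz; assert (H1 := w_dq W z Hz); assert (H2 := g_ddu G z Hz).
  assert (Hq := w_q_pos W z Hz); derive; field; lra. }
destruct (near_height (u 0 - b)) as [x [Hx Hst]]; [lra|].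
assert (Hpos : forall z, 0 < z <= x -> 0 < q z * f (u z)).
{ intros z Hz; destruct (Hst z Hz) as [Huz _]; apply Rabs_def2 in Huz.
  apply Rmult_lt_0_compat; [apply (w_q_pos W); lra|].
  apply (n_f_pos N); [lra | apply (g_range G); lra]. }
assert (Hdecr : forall s t, 0 < s -> s < t -> t <= x -> q t * du t < q s * du s).
{ intros s t Hs Hst' Ht.
  apply (decr_of_derive (fun t => q t * du t) (fun z => - (q z * f (u z)))); [exact Hst' | |];
    intros z Hz; [apply Hdm; lra | assert (Hp := Hpos z ltac:(lra)); lra]. }
assert (Hstart : forall t, 0 < t <= x -> q t * du t < 0).
{ intros t Ht.
  apply Rlt_le_trans with (q (t / 2) * du (t / 2)); [apply Hdecr; lra|].
  apply le_epsilon; intros e He.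
  assert (Hq1 := w_q_pos W x ltac:(lra)).
  destruct (near_height (Rmin (t / 2) (e / q x))) as [y [Hy Hsty]].
  { apply Rmin_case; [lra | apply Rdiv_lt_0_compat; lra]. }
  assert (Hm1 := Rmin_l (t / 2) (e / q x)); assert (Hm2 := Rmin_r (t / 2) (e / q x)).
  destruct (Hsty y ltac:(lra)) as [_ Hduy]; apply Rabs_def2 in Hduy.
  assert (Hd := Hdecr y (t / 2) ltac:(lra) ltac:(lra) ltac:(lra)).
  assert (Hqy := q_nondecr W y x ltac:(lra) ltac:(lra)).
  assert (Hqy0 := w_q_pos W y ltac:(lra)).
  assert (Hqe : q x * (e / q x) = e) by (field; lra).
  assert (He' : 0 < e / q x) by (apply Rdiv_lt_0_compat; lra).
  nra. }
destruct (Rle_dec r x) as [Hrx | Hrx].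
- assert (Hn := Hstart r ltac:(lra)); assert (Hq := w_q_pos W r Hr); nra.
- assert (Hn : q r * du r < 0).
  { apply (negative_persists (fun t => q t * du t) (fun z => - (q z * f (u z))) x r); [lra | | |].
    - intros z Hz; apply Hdm; lra.
    - apply Hstart; lra.
    - intros z Hz Hz0; simpl in Hz0.
      assert (Hqz := w_q_pos W z ltac:(lra)).
      assert (Hduz : du z = 0) by (apply Rmult_integral in Hz0; destruct Hz0; lra).
      assert (Huz := positive_before z r ltac:(lra) ltac:(lra) Hur).
      assert (HE := energy_pos z ltac:(lra) Huz).
      unfold energy in HE; rewrite Hduz in HE; simpl in HE.
      assert (Hbz : beta < u z).
      { apply Rnot_le_lt; intros Hle.
        assert (HF := F_nonpos N (u z) ltac:(lra)); lra. }
      assert (Hfz := n_f_pos N (u z) ltac:(lra) (g_range G z ltac:(lra))).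
      nra. }
  assert (Hq := w_q_pos W r Hr); nra.
Qed.

Lemma u_decr x y : 0 < x -> x < y -> 0 < u x -> u y < u x.
Proof.
intros Hx Hxy Hu.
destruct (g_nonneg G y ltac:(lra)) as [Hy | Hy]; [|lra].
apply (decr_of_derive u du); [exact Hxy | |]; intros z Hz.
- apply (g_du G); lra.
- apply du_neg; [lra | apply (positive_before z y); lra].
Qed.

Lemma u_nonincr x y : 0 < x -> x <= y -> u y <= u x.
Proof.
intros Hx [Hxy | <-]; [|lra].
destruct (g_nonneg G x ltac:(lra)) as [Hu | Hu].
- left; apply u_decr; assumption.
- rewrite (zero_persists x y Hx (Rlt_le _ _ Hxy) (eq_sym Hu)); lra.
Qed.

Lemma u_lt_height x : 0 < x -> u x < u 0.
Proof.
intros Hx; assert (Hu0 := g_height G).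
destruct (g_nonneg G x ltac:(lra)) as [Hu | Hu]; [|lra].
assert (Hu2 := positive_before (x / 2) x ltac:(lra) ltac:(lra) Hu).
apply Rlt_le_trans with (u (x / 2)); [apply u_decr; lra|].
apply le_epsilon; intros e He.
destruct (near_height (Rmin e (x / 2))) as [y [Hy Hst]]; [apply Rmin_case; lra|].
assert (Hm1 := Rmin_l e (x / 2)); assert (Hm2 := Rmin_r e (x / 2)).
destruct (Hst y ltac:(lra)) as [Huy _]; apply Rabs_def2 in Huy.
assert (Hm := u_nonincr y (x / 2) ltac:(lra) ltac:(lra)); lra.
Qed.

Lemma value_attained s : 0 < s < u 0 -> exists r, 0 < r /\ u r = s.
Proof.
intros Hs.
destruct (near_height (u 0 - s)) as [x [Hx Hst]]; [lra|].
destruct (Hst x ltac:(lra)) as [Hux _]; apply Rabs_def2 in Hux.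
destruct (g_end G s ltac:(lra)) as [M HM].
assert (Hm1 := Rmax_l x (M + 1)); assert (Hm2 := Rmax_r x (M + 1)).
specialize (HM (Rmax x (M + 1)) ltac:(lra)).
destruct (first_zero (fun t => s - u t) x (Rmax x (M + 1))) as [r [Hr [Hr0 _]]].
- exact Hm1.
- intros z Hz; assert (Hd := g_du G z ltac:(lra)).
  eapply continuous_of_derive; derive; reflexivity.
- lra.
- lra.
- exists r; split; lra.
Qed.

Definition radius (s : R) : R :=
  epsilon (inhabits 0) (fun r => 0 < r /\ u r = s).

Lemma radius_spec s : 0 < s < u 0 -> 0 < radius s /\ u (radius s) = s.
Proof.
intros Hs.
exact (epsilon_spec (inhabits 0) (fun r => 0 < r /\ u r = s) (value_attained s Hs)).
Qed.

Lemma radius_lt s x : 0 < s < u 0 -> 0 < x -> u x < s -> radius s < x.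
Proof.
intros Hs Hx Hux; destruct (radius_spec s Hs) as [Hr Hur].
apply Rnot_le_lt; intros Hle; assert (Hm := u_nonincr x (radius s) Hx Hle); lra.
Qed.

Lemma radius_gt s x : 0 < s < u 0 -> 0 < x -> s < u x -> x < radius s.
Proof.
intros Hs Hx Hux; destruct (radius_spec s Hs) as [Hr Hur].
apply Rnot_le_lt; intros Hle; assert (Hm := u_nonincr (radius s) x Hr Hle); lra.
Qed.

Lemma radius_of_value x : 0 < x -> 0 < u x -> radius (u x) = x.
Proof.
intros Hx Hu.
destruct (radius_spec (u x) (conj Hu (u_lt_height x Hx))) as [Hr Hur].
destruct (Rtotal_order (radius (u x)) x) as [Hlt | [Heq | Hgt]]; [|exact Heq|]; exfalso.
- assert (Hm := u_decr _ _ Hr Hlt ltac:(lra)); lra.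
- assert (Hm := u_decr _ _ Hx Hgt Hu); lra.
Qed.

Lemma continuous_radius s : 0 < s < u 0 -> continuous radius s.
Proof.
intros Hs P [e He].
destruct (radius_spec s Hs) as [Hr Hur].
set (k := Rmin (e / 2) (radius s / 2)).
assert (He0 := cond_pos e).
assert (Hk : 0 < k) by (apply Rmin_case; lra).
assert (Hk1 : k <= e / 2) by apply Rmin_l.
assert (Hk2 : k <= radius s / 2) by apply Rmin_r.
assert (Hlo : u (radius s + k) < s) by (rewrite <- Hur at 2; apply u_decr; lra).
assert (Hup : s < u (radius s - k)).
{ rewrite <- Hur at 1; apply u_decr; try lra; apply (positive_before _ (radius s)); lra. }
change (locally s (fun t => P (radius t))).
apply (filter_imp (fun t => (u (radius s + k) < t /\ t < u (radius s - k)) /\ 0 < t < u 0)).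
- intros t [[Ht1 Ht2] Ht]; apply He.
  assert (H1 := radius_lt t (radius s + k) Ht ltac:(lra) Ht1).
  assert (H2 := radius_gt t (radius s - k) Ht ltac:(lra) Ht2).
  unfold ball; simpl; unfold AbsRing_ball, abs, minus, plus, opp; simpl.
  apply Rabs_def1; lra.
- repeat apply filter_and;
    first [apply (open_gt (u (radius s + k))); lra | apply (open_lt (u (radius s - k))); lra
          | apply (open_gt 0); lra | apply (open_lt (u 0)); lra].
Qed.

Lemma is_derive_radius s : 0 < s < u 0 -> is_derive radius s (/ du (radius s)).
Proof.
intros Hs; destruct (radius_spec s Hs) as [Hr Hur].
apply (is_derive_inverse u).
- apply continuous_radius, Hs.
- apply (filter_imp (fun t => 0 < t /\ t < u 0)).
  + intros t Ht; apply radius_spec, Ht.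
  + apply filter_and; [apply (open_gt 0) | apply (open_lt (u 0))]; lra.
- apply (g_du G), Hr.
- assert (Hd := du_neg _ Hr ltac:(lra)); lra.
Qed.

(** If [u] vanishes at a finite point, the energy tends to 0 there. *)
Lemma scaled_speed_end_compact e s1 R0 : 0 < e -> 0 < s1 -> 0 < R0 -> u R0 = 0 ->
  exists r, 0 < r /\ 0 < u r < s1 /\ Q r / q r * sqrt (2 * energy r) < e.
Proof.
intros He Hs1 HR Hu.
destruct (near_height (u 0) (g_height G)) as [x [Hx Hst]].
destruct (Hst x ltac:(lra)) as [Hux _]; apply Rabs_def2 in Hux.
assert (HxR : x < R0).
{ apply Rnot_le_lt; intros Hle; assert (Hz := zero_persists R0 x HR Hle Hu); lra. }
destruct (first_zero (fun t => - u t) x R0) as [z [Hz [Hz0 Hzn]]].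
- lra.
- intros t Ht; assert (Hd := g_du G t ltac:(lra)).
  eapply continuous_of_derive; derive; reflexivity.
- lra.
- lra.
- assert (Hd1 := g_du G z ltac:(lra)).
  assert (Hd2 := is_derive_energy z ltac:(lra)).
  assert (Hd3 := is_derive_ratio W z ltac:(lra)).
  destruct (continuous_neg_near (fun t => u t - s1) z) as [d1 [Hd1' Hn1]].
  + eapply continuous_of_derive; derive; reflexivity.
  + lra.
  + destruct (continuous_neg_near (fun t => (Q t / q t) ^ 2 * (2 * energy t) - e ^ 2) z)
      as [d2 [Hd2' Hn2]].
    * eapply continuous_of_derive; derive; reflexivity.
    * rewrite energy_zero by lra; nra.
    * set (d := Rmin (z - x) (Rmin d1 d2)).
      assert (Hd : 0 < d) by (repeat apply Rmin_case; lra).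
      assert (Hm1 : d <= z - x) by apply Rmin_l.
      assert (Hm2 : d <= d1) by (apply Rle_trans with (1 := Rmin_r _ _), Rmin_l).
      assert (Hm3 : d <= d2) by (apply Rle_trans with (1 := Rmin_r _ _), Rmin_r).
      exists (z - d / 2).
      specialize (Hn1 (z - d / 2) ltac:(apply Rabs_def1; lra)).
      specialize (Hn2 (z - d / 2) ltac:(apply Rabs_def1; lra)).
      specialize (Hzn (z - d / 2) ltac:(lra)); simpl in Hn1, Hn2, Hzn.
      split; [lra|]; split; [lra|].
      assert (HE := energy_pos (z - d / 2) ltac:(lra) ltac:(lra)).
      assert (HA := ratio_pos W (z - d / 2) ltac:(lra)).
      assert (Hw := sqrt_lt_R0 (2 * energy (z - d / 2)) ltac:(lra)).
      assert (Hsq := pow2_sqrt (2 * energy (z - d / 2)) ltac:(lra)).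
      apply Rsqr_incrst_0; [|apply Rmult_le_pos; lra | lra].
      unfold Rsqr; simpl in Hsq; rewrite <- Hsq in Hn2.
      replace (e * e) with (e ^ 2) by ring; simpl in Hn2; simpl; nra.
Qed.

(** Below beta, q^2 times the energy decreases in r, as F <= 0; and Q / q^2 tends to 0. *)
Lemma scaled_speed_end_unbounded e s1 : 0 < e -> 0 < s1 -> (forall r, 0 < r -> 0 < u r) ->
  exists r, 0 < r /\ 0 < u r < s1 /\ Q r / q r * sqrt (2 * energy r) < e.
Proof.
intros He Hs1 Hpos.
assert (Hh := height_above_beta).
destruct (radius_spec beta ltac:(lra)) as [Hrb Hurb].
set (rb := radius beta) in *.
set (V := fun r => q r ^ 2 * (2 * energy r)).
assert (HV : forall r, rb <= r -> V r <= V rb).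
{ intros r Hr.
  apply (nonincr_of_derive V (fun t => 4 * (q t * dq t) * F (u t))); [exact Hr | |]; intros z Hz.
  - assert (H1 := is_derive_energy z ltac:(lra)); assert (H2 := w_dq W z ltac:(lra)).
    assert (Hq := w_q_pos W z ltac:(lra)).
    unfold V; derive; simpl; unfold energy; field; lra.
  - assert (HF := F_nonpos N (u z)).
    assert (Hu := u_nonincr rb z Hrb ltac:(lra)).
    assert (Hu0 := g_nonneg G z ltac:(lra)).
    specialize (HF ltac:(lra)).
    assert (Hq := w_q_pos W z ltac:(lra)); assert (Hq' := w_dq_pos W z ltac:(lra)).
    assert (0 < q z * dq z) by (apply Rmult_lt_0_compat; assumption); nra. }
assert (Hqb := w_q_pos W rb Hrb).
assert (HEb := energy_pos rb Hrb ltac:(lra)).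
assert (HVb : 0 < V rb) by (apply Rmult_lt_0_compat; [apply pow_lt; lra | lra]).
assert (HC := sqrt_lt_R0 _ HVb).
destruct (ratio2_vanishes W (e / sqrt (V rb))) as [r0 [Hr0 Hrat]].
{ apply Rdiv_lt_0_compat; lra. }
destruct (g_end G s1 Hs1) as [M HM].
set (r := Rmax (Rmax r0 rb) (M + 1)).
assert (Hm1 : r0 <= r) by (apply Rle_trans with (2 := Rmax_l _ _), Rmax_l).
assert (Hm2 : rb <= r) by (apply Rle_trans with (2 := Rmax_l _ _), Rmax_r).
assert (Hm3 : M + 1 <= r) by apply Rmax_r.
exists r; split; [lra|]; split; [split; [apply Hpos | apply HM]; lra|].
specialize (Hrat r Hm1); specialize (HV r Hm2).
assert (Hq := w_q_pos W r ltac:(lra)).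
assert (HE := energy_pos r ltac:(lra) (Hpos r ltac:(lra))).
assert (HsV : sqrt (V r) = q r * sqrt (2 * energy r)).
{ unfold V; rewrite sqrt_mult, sqrt_pow2; [reflexivity | lra | apply pow2_ge_0 | lra]. }
replace (Q r / q r * sqrt (2 * energy r)) with (Q r / q r / q r * sqrt (V r))
  by (rewrite HsV; field; lra).
apply Rle_lt_trans with (Q r / q r / q r * sqrt (V rb)).
- apply Rmult_le_compat_l; [|apply sqrt_le_1_alt, HV].
  left; apply Rdiv_lt_0_compat; [apply (ratio_pos W); lra | lra].
- apply Rlt_le_trans with (e / sqrt (V rb) * sqrt (V rb)).
  + apply Rmult_lt_compat_r; assumption.
  + right; field; lra.
Qed.

Lemma ground_state_profile : profile q dq Q f F (u 0) radius (fun s => - du (radius s)).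
Proof.
assert (Hslope : forall s, 0 < s < u 0 -> 0 < - du (radius s)).
{ intros s Hs; destruct (radius_spec s Hs) as [Hr Hur].
  assert (Hd := du_neg _ Hr ltac:(lra)); lra. }
assert (Hen : forall s, 0 < s < u 0 -> (- du (radius s)) ^ 2 + 2 * F s = 2 * energy (radius s)).
{ intros s Hs; destruct (radius_spec s Hs) as [Hr Hur]; unfold energy; rewrite Hur; field. }
assert (Hdr : forall s, 0 < s < u 0 -> is_derive radius s (- / - du (radius s))).
{ intros s Hs; eapply is_derive_eq; [apply is_derive_radius, Hs|].
  assert (Hd := Hslope s Hs); field; lra. }
split.
- intros s Hs; apply radius_spec, Hs.
- exact Hslope.
- exact Hdr.
- intros s Hs; destruct (radius_spec s Hs) as [Hr Hur].
  assert (Hd := Hslope s Hs); assert (Hq := w_q_pos W _ Hr).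
  eapply is_derive_eq.
  + apply is_derive_opp_R, (is_derive_comp_R du radius); [apply (g_ddu G), Hr | apply Hdr, Hs].
  + rewrite Hur; field; lra.
- intros s Hs; destruct (radius_spec s Hs) as [Hr Hur].
  rewrite Hen by exact Hs; assert (HE := energy_pos _ Hr ltac:(lra)); lra.
- intros e He; assert (Hu0 := g_height G).
  destruct (near_height e He) as [x [Hx Hst]].
  assert (Hux := u_lt_height x ltac:(lra)).
  assert (Hm1 := Rmax_l (u x) (u 0 / 2)); assert (Hm2 := Rmax_r (u x) (u 0 / 2)).
  exists (Rmax (u x) (u 0 / 2)); split; [split; [lra | apply Rmax_lub_lt; lra]|].
  intros s Hs; assert (Hs0 : 0 < s < u 0) by lra.
  destruct (radius_spec s Hs0) as [Hr Hur].
  assert (Hrx := radius_lt s x Hs0 ltac:(lra) ltac:(lra)).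
  destruct (Hst (radius s) ltac:(lra)) as [_ Hd]; apply Rabs_def2 in Hd; lra.
- intros e s1 He Hs1.
  assert (Hend : exists r, 0 < r /\ 0 < u r < s1 /\ Q r / q r * sqrt (2 * energy r) < e).
  { destruct (Classical_Prop.classic (exists R0, 0 < R0 /\ u R0 = 0)) as [[R0 [HR HuR]] | Hno].
    - apply (scaled_speed_end_compact e s1 R0); assumption.
    - apply scaled_speed_end_unbounded; [exact He | exact Hs1 |].
      intros r Hr; destruct (g_nonneg G r ltac:(lra)) as [|Hz]; [assumption|].
      exfalso; apply Hno; exists r; split; [exact Hr | symmetry; exact Hz]. }
  destruct Hend as [r [Hr [Hur Hsm]]].
  exists (u r); assert (Hlt := u_lt_height r Hr).
  split; [lra|]; split; [exact Hlt|].
  rewrite Hen by lra; rewrite radius_of_value by lra; exact Hsm.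
Qed.

End GroundState.

(** * Solutions of equal height coincide *)

Lemma lipschitz_of_derive (f df : R -> R) (lo hi : R) :
  lo <= hi ->
  (forall s, lo <= s <= hi -> is_derive f s (df s)) ->
  (forall s, lo <= s <= hi -> continuous df s) ->
  exists L, 0 <= L /\
    forall x y, lo <= x <= hi -> lo <= y <= hi -> Rabs (f x - f y) <= L * Rabs (x - y).
Proof.
intros Hlh Hd Hc.
destruct (continuity_ab_maj (fun s => Rabs (df s)) lo hi Hlh) as [M [HM _]].
{ intros s Hs; apply continuity_pt_filterlim.
  apply (continuous_comp df Rabs); [apply Hc, Hs | apply continuous_Rabs]. }
exists (Rabs (df M)); split; [apply Rabs_pos|].
assert (Hlt : forall x y, lo <= x -> x < y -> y <= hi ->
  Rabs (f y - f x) <= Rabs (df M) * Rabs (y - x)).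
{ intros x y Hx Hxy Hy.
  destruct (MVT_cor2 f df x y Hxy) as [z [Hz Hzi]].
  - intros z Hz; apply is_derive_Reals, Hd; lra.
  - rewrite Hz, Rabs_mult; apply Rmult_le_compat_r; [apply Rabs_pos | apply HM; lra]. }
intros x y Hx Hy; destruct (Rtotal_order x y) as [Hxy | [<- | Hxy]].
- rewrite (Rabs_minus_sym (f x)), (Rabs_minus_sym x); apply Hlt; lra.
- rewrite !Rminus_diag, Rabs_R0; lra.
- apply Hlt; lra.
Qed.

Section EqualHeight.
Context {q dq Q K : R -> R} {H0 Hinf : R} (W : weight q dq Q K H0 Hinf).
Context {c : Rbar} {f F dG : R -> R} {b beta : R}.
Context (N : nonlinearity c f F dG b beta Hinf).
Context {df : R -> R} (Hdf : forall s, 0 < s -> Rbar_lt s c -> is_derive f s (df s)).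
Context (Hdfc : forall s, 0 < s -> Rbar_lt s c -> continuous df s).
Context {u du v dv : R -> R}.
Context (Gu : ground_state c q dq f u du) (Gv : ground_state c q dq f v dv).
Context (Huv : u 0 = v 0).

(** The friction term has a favourable sign, so the estimate of (u - v)^2 + (u' - v')^2 is not
    affected by the singularity of q'/q at 0. *)
Lemma agree_where_positive R0 : 0 < R0 -> 0 < u R0 -> 0 < v R0 -> u R0 = v R0.
Proof.
intros HR Hu Hv.
assert (Hh := g_height Gu).
set (lo := Rmin (u R0) (v R0)).
assert (Hlo : 0 < lo) by (apply Rmin_case; lra).
assert (Hl1 : lo <= u R0) by apply Rmin_l.
assert (Hl2 : lo <= v R0) by apply Rmin_r.
assert (Hur : forall r, 0 < r <= R0 -> lo <= u r <= u 0).
{ intros r Hr.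
  assert (H1 := u_nonincr W N Gu r R0 ltac:(lra) ltac:(lra)).
  assert (H2 := u_lt_height W N Gu r ltac:(lra)); lra. }
assert (Hvr : forall r, 0 < r <= R0 -> lo <= v r <= u 0).
{ intros r Hr.
  assert (H1 := u_nonincr W N Gv r R0 ltac:(lra) ltac:(lra)).
  assert (H2 := u_lt_height W N Gv r ltac:(lra)); lra. }
assert (Hc := g_range Gu 0 (Rle_refl 0)).
destruct (lipschitz_of_derive f df lo (u 0)) as [L [HL Hlip]].
- specialize (Hur R0 ltac:(lra)); lra.
- intros s Hs; apply Hdf; [lra | apply (Rbar_le_lt_trans_R s (u 0)); [lra | exact Hc]].
- intros s Hs; apply Hdfc; [lra | apply (Rbar_le_lt_trans_R s (u 0)); [lra | exact Hc]].
- set (D := fun r => (u r - v r) ^ 2 + (du r - dv r) ^ 2).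
  assert (Hmon : forall x, 0 < x <= R0 ->
    D R0 * exp (- (R0 * (1 + L))) <= D x * exp (- (x * (1 + L)))).
  { intros x Hx.
    apply (nonincr_of_derive (fun r => D r * exp (- (r * (1 + L))))
      (fun r => (2 * (u r - v r) * (du r - dv r)
        + 2 * (du r - dv r) * (- (f (u r) - f (v r)) - dq r / q r * (du r - dv r))
        - (1 + L) * D r) * exp (- (r * (1 + L))))); [lra | |]; intros z Hz.
    - assert (G1 := g_du Gu z ltac:(lra)); assert (G2 := g_ddu Gu z ltac:(lra)).
      assert (G3 := g_du Gv z ltac:(lra)); assert (G4 := g_ddu Gv z ltac:(lra)).
      assert (G5 : is_derive (fun r => exp (- (r * (1 + L)))) z
        (- (1 + L) * exp (- (z * (1 + L))))).
      { apply (is_derive_comp_R exp (fun r => - (r * (1 + L))));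
          [apply is_derive_exp | derive; ring]. }
      assert (Hq := w_q_pos W z ltac:(lra)).
      unfold D; derive; simpl; field; lra.
    - assert (Hh' := log_derive_pos W z ltac:(lra)).
      assert (Hl := Hlip (u z) (v z) (Hur z ltac:(lra)) (Hvr z ltac:(lra))).
      assert (He := exp_pos (- (z * (1 + L)))).
      unfold D.
      set (x0 := u z - v z) in *; set (y0 := du z - dv z) in *.
      set (g0 := f (u z) - f (v z)) in *.
      assert (Hxy : 2 * Rabs x0 * Rabs y0 <= x0 ^ 2 + y0 ^ 2).
      { rewrite <- (pow2_abs x0), <- (pow2_abs y0).
        assert (Hs := pow2_ge_0 (Rabs x0 - Rabs y0)); nra. }
      assert (H1 : x0 * y0 <= Rabs x0 * Rabs y0) by (rewrite <- Rabs_mult; apply Rle_abs).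
      assert (H2 : - g0 * y0 <= L * (Rabs x0 * Rabs y0)).
      { apply Rle_trans with (Rabs g0 * Rabs y0).
        - rewrite <- (Rabs_Ropp g0), <- Rabs_mult; apply Rle_abs.
        - rewrite <- Rmult_assoc; apply Rmult_le_compat_r; [apply Rabs_pos | exact Hl]. }
      assert (H3 : 0 <= dq z / q z * y0 ^ 2) by (apply Rmult_le_pos; [lra | apply pow2_ge_0]).
      assert (H4 : L * (2 * Rabs x0 * Rabs y0) <= L * (x0 ^ 2 + y0 ^ 2))
        by (apply Rmult_le_compat_l; lra).
      assert (Hneg : 2 * x0 * y0 + 2 * y0 * (- g0 - dq z / q z * y0)
        - (1 + L) * (x0 ^ 2 + y0 ^ 2) <= 0).
      { replace (2 * x0 * y0 + 2 * y0 * (- g0 - dq z / q z * y0)) with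
          (2 * (x0 * y0) + 2 * (- g0 * y0) - 2 * (dq z / q z * y0 ^ 2)) by ring.
        lra. }
      nra. }
  assert (HD : D R0 <= 0).
  { set (C := exp (R0 * (1 + L))).
    assert (HC : 0 < C) by apply exp_pos.
    apply le_epsilon; intros e He.
    set (eta := Rmin 1 (Rmin R0 (e / (8 * C)))).
    assert (Heta : 0 < eta).
    { repeat apply Rmin_case; try lra; apply Rdiv_lt_0_compat; lra. }
    assert (Hm1 : eta <= 1) by apply Rmin_l.
    assert (Hm2 : eta <= R0) by (apply Rle_trans with (1 := Rmin_r _ _), Rmin_l).
    assert (Hm3 : eta <= e / (8 * C)) by (apply Rle_trans with (1 := Rmin_r _ _), Rmin_r).
    destruct (near_height Gu eta Heta) as [x1 [Hx1 Hs1]].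
    destruct (near_height Gv eta Heta) as [x2 [Hx2 Hs2]].
    set (x := Rmin x1 x2).
    assert (Hx : 0 < x) by (apply Rmin_case; lra).
    assert (Hxa : x <= x1) by apply Rmin_l.
    assert (Hxb : x <= x2) by apply Rmin_r.
    destruct (Hs1 x ltac:(lra)) as [A1 A2]; apply Rabs_def2 in A1; apply Rabs_def2 in A2.
    destruct (Hs2 x ltac:(lra)) as [B1 B2]; apply Rabs_def2 in B1; apply Rabs_def2 in B2.
    assert (HDx : D x <= 8 * eta).
    { unfold D.
      assert (Hsq : forall t, - (2 * eta) <= t <= 2 * eta -> t ^ 2 <= 4 * eta).
      { intros t Ht; assert (0 <= (2 * eta - t) * (2 * eta + t)) by (apply Rmult_le_pos; lra).
        nra. }
      rewrite <- Huv in B1.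
      assert (Hx1' := Hsq (u x - v x) ltac:(lra)).
      assert (Hx2' := Hsq (du x - dv x) ltac:(lra)).
      lra. }
    assert (HD0 : 0 <= D x).
    { unfold D; assert (Ha := pow2_ge_0 (u x - v x)); assert (Hb := pow2_ge_0 (du x - dv x)); lra. }
    assert (Hm := Hmon x ltac:(lra)).
    assert (Hex : exp (- (x * (1 + L))) <= 1).
    { assert (0 < x * (1 + L)) by (apply Rmult_lt_0_compat; lra).
      rewrite <- exp_0 at 2; left; apply exp_increasing; lra. }
    assert (HeR : exp (- (R0 * (1 + L))) = / C) by (unfold C; apply exp_Ropp).
    rewrite HeR in Hm.
    assert (Hex0 := exp_pos (- (x * (1 + L)))).
    assert (Hle : D R0 * / C <= 8 * eta) by nra.
    apply (Rmult_le_compat_r C) in Hle; [|lra].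
    rewrite Rmult_assoc, Rinv_l, Rmult_1_r in Hle by lra.
    assert (8 * C * eta <= e).
    { apply Rle_trans with (8 * C * (e / (8 * C))); [apply Rmult_le_compat_l; lra|].
      right; field; lra. }
    lra. }
  unfold D in HD.
  assert (Hb := pow2_ge_0 (du R0 - dv R0)); assert (Ha := pow2_ge_0 (u R0 - v R0)).
  destruct (Req_dec (u R0 - v R0) 0) as [|Hne]; [lra|].
  assert (Hc' := pow2_gt_0 _ Hne); lra.
Qed.

(** While [v] is positive it cannot separate from [u], so [u] cannot vanish first. *)
Lemma common_support r : 0 < r -> 0 < v r -> 0 < u r.
Proof.
intros Hr Hv.
destruct (g_nonneg Gu r ltac:(lra)) as [|Hu]; [assumption | exfalso].
destruct (near_height Gu (u 0) (g_height Gu)) as [x [Hx Hst]].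
destruct (Hst x ltac:(lra)) as [Hux _]; apply Rabs_def2 in Hux.
assert (Hxr : x < r).
{ apply Rnot_le_lt; intros Hle.
  assert (Hz := zero_persists W N Gu r x Hr Hle (eq_sym Hu)); lra. }
destruct (first_zero (fun t => - u t) x r) as [z [Hz [Hz0 Hzn]]]; [lra | | lra | lra |].
{ intros t Ht; assert (Hd := g_du Gu t ltac:(lra)).
  eapply continuous_of_derive; derive; reflexivity. }
destruct (continuous_neg_near (fun t => u t - v r) z) as [d [Hd Hn]].
- assert (Hdz := g_du Gu z ltac:(lra)); eapply continuous_of_derive; derive; reflexivity.
- lra.
- set (y := Rmax x (z - d / 2)).
  assert (Hy1 : x <= y) by apply Rmax_l.
  assert (Hy2 : z - d / 2 <= y) by apply Rmax_r.
  assert (Hy3 : y < z) by (apply Rmax_lub_lt; lra).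
  specialize (Hn y ltac:(apply Rabs_def1; lra)); specialize (Hzn y ltac:(lra)).
  simpl in Hn, Hzn.
  assert (Hvy := u_nonincr W N Gv y r ltac:(lra) ltac:(lra)).
  assert (He := agree_where_positive y ltac:(lra) ltac:(lra) ltac:(lra)); lra.
Qed.

End EqualHeight.

Lemma equal_height_unique {q dq Q K H0 Hinf} (W : weight q dq Q K H0 Hinf)
  {c f F dG b beta} (N : nonlinearity c f F dG b beta Hinf) {df}
  (Hdf : forall s, 0 < s -> Rbar_lt s c -> is_derive f s (df s))
  (Hdfc : forall s, 0 < s -> Rbar_lt s c -> continuous df s)
  {u du v dv} (Gu : ground_state c q dq f u du) (Gv : ground_state c q dq f v dv) :
  u 0 = v 0 -> forall r, 0 <= r -> u r = v r.
Proof.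
intros Huv r [Hr | <-]; [|exact Huv].
destruct (g_nonneg Gu r ltac:(lra)) as [Hu | Hu].
- assert (Hv := common_support W N Hdf Hdfc Gv Gu
    (eq_sym Huv) r Hr Hu).
  exact (agree_where_positive W N Hdf Hdfc Gu Gv Huv r Hr Hu Hv).
- destruct (g_nonneg Gv r ltac:(lra)) as [Hv | Hv]; [|lra].
  assert (Hu' := common_support W N Hdf Hdfc Gu Gv Huv r Hr Hv).
  lra.
Qed.

Lemma ground_state_unique {q dq Q K H0 Hinf} (W : weight q dq Q K H0 Hinf)
  {c f F dG b beta} (N : nonlinearity c f F dG b beta Hinf) {df}
  (Hdf : forall s, 0 < s -> Rbar_lt s c -> is_derive f s (df s))
  (Hdfc : forall s, 0 < s -> Rbar_lt s c -> continuous df s)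
  {u du v dv} (Gu : ground_state c q dq f u du) (Gv : ground_state c q dq f v dv) :
  forall r, 0 <= r -> u r = v r.
Proof.
assert (Pu := ground_state_profile W N Gu).
assert (Pv := ground_state_profile W N Gv).
assert (Bu := height_above_beta W N Gu).
assert (Bv := height_above_beta W N Gv).
assert (Cu := g_range Gu 0 (Rle_refl 0)); assert (Cv := g_range Gv 0 (Rle_refl 0)).
destruct (Rtotal_order (u 0) (v 0)) as [Hlt | [Heq | Hgt]].
- destruct (heights_not_ordered W N Bu Hlt Cv Pu Pv).
- exact (equal_height_unique W N Hdf Hdfc Gu Gv Heq).
- destruct (heights_not_ordered W N Bv Hgt Cu Pv Pu).
Qed.

(** * From the hypotheses to weights, nonlinearities and ground states *)

Lemma ball_R (x y e : R) : ball x e y <-> Rabs (y - x) < e.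
Proof. reflexivity. Qed.

Lemma half_derive_spec (g : R -> R) (r l : R) : 0 <= r -> is_derive_half g r l ->
  forall e, 0 < e -> exists d, 0 < d /\ forall y, 0 <= y -> y <> r -> Rabs (y - r) < d ->
    Rabs ((g y - g r) / (y - r) - l) < e.
Proof.
intros Hr Hg e He.
destruct (Hg (fun z => Rabs (z - l) < e)) as [d Hd].
- exists (mkposreal e He); intros z Hz; exact Hz.
- exists d; split; [apply cond_pos|]; intros y Hy Hyr Hyd; apply Hd; assumption.
Qed.

Lemma half_derive_interior (g : R -> R) (r l : R) : 0 < r -> is_derive_half g r l ->
  is_derive g r l.
Proof.
intros Hr Hg; apply is_derive_Reals; intros e He.
destruct (half_derive_spec g r l ltac:(lra) Hg e He) as [d [Hd Hd']].
assert (Hm : 0 < Rmin d r) by (apply Rmin_case; lra).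
exists (mkposreal _ Hm); simpl; intros h Hh0 Hh.
assert (Hm1 := Rmin_l d r); assert (Hm2 := Rmin_r d r).
assert (Hh' : - r < h) by (apply Rabs_def2 in Hh; lra).
specialize (Hd' (r + h) ltac:(lra) ltac:(lra)).
replace (r + h - r) with h in Hd' by ring; apply Hd'; lra.
Qed.

Lemma half_derive_start (g : R -> R) (l : R) : is_derive_half g 0 l ->
  forall e, 0 < e -> exists d, 0 < d /\ forall r, 0 < r < d -> Rabs (g r - g 0) < e.
Proof.
intros Hg e He.
destruct (half_derive_spec g 0 l (Rle_refl 0) Hg 1 Rlt_0_1) as [d [Hd Hd']].
assert (Hl : 0 < Rabs l + 1) by (assert (H := Rabs_pos l); lra).
assert (Hel : 0 < e / (Rabs l + 1)) by (apply Rdiv_lt_0_compat; lra).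
exists (Rmin d (e / (Rabs l + 1))); split; [apply Rmin_case; lra|]; intros r Hr.
assert (Hm1 := Rmin_l d (e / (Rabs l + 1))); assert (Hm2 := Rmin_r d (e / (Rabs l + 1))).
specialize (Hd' r ltac:(lra) ltac:(lra) ltac:(apply Rabs_def1; lra)).
rewrite Rminus_0_r in Hd'.
assert (Hq : Rabs ((g r - g 0) / r) < Rabs l + 1).
{ replace ((g r - g 0) / r) with (((g r - g 0) / r - l) + l) by ring.
  assert (Ht := Rabs_triang ((g r - g 0) / r - l) l); lra. }
replace (g r - g 0) with ((g r - g 0) / r * r) by (field; lra).
rewrite Rabs_mult, (Rabs_pos_eq r) by lra.
apply Rlt_le_trans with ((Rabs l + 1) * (e / (Rabs l + 1))); [|right; field; lra].
apply Rmult_le_0_lt_compat; try lra; apply Rabs_pos.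
Qed.

Lemma weight_of_conditions (q : R -> R) (H0 Hinf : R) :
  cond_q1 q -> cond_q2 q -> cond_q3 q H0 Hinf ->
  weight q (Derive q) (Defs.primitive q) (H q) H0 Hinf.
Proof.
intros [[dq [Hdq Hdqc]] Hqn Hq0 Hqi] Hq2 [HKn HK0 HH0 HKinf HHinf Hex].
assert (Hd : forall r, 0 < r -> is_derive q r (Derive q r)).
{ intros r Hr; apply Derive_correct; exists (dq r).
  apply half_derive_interior; [exact Hr | apply Hdq; lra]. }
assert (Hq : forall r, 0 < r -> 0 < q r).
{ intros r Hr; apply Rle_lt_trans with (q (r / 2)); [apply Hqn; lra|].
  apply (incr_of_derive q (Derive q)); [lra | |]; intros z Hz; [apply Hd | apply Hqi]; lra. }
(* Extending [q] by 0 makes it continuous on the line. *)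
set (q' := fun r => if Rle_dec r 0 then 0 else q r).
assert (Hq'q : forall r, 0 < r -> q' r = q r).
{ intros r Hr; unfold q'; destruct (Rle_dec r 0); lra. }
assert (Hc : forall r, continuous q' r).
{ intros r; destruct (Rtotal_order r 0) as [Hr | [-> | Hr]].
  - apply (continuous_ext_loc q' (fun _ => 0) r); [|apply continuous_const].
    apply (filter_imp (fun t => t < 0)); [|apply (open_lt 0), Hr].
    intros t Ht; unfold q'; destruct (Rle_dec t 0); lra.
  - intros P [e He].
    destruct (half_derive_start q _ (Hdq 0 (Rle_refl 0)) e (cond_pos e)) as [d [Hd0 Hd']].
    exists (mkposreal d Hd0); intros t Ht; apply He; apply ball_R; change (Rabs (t - 0) < d) in Ht.
    apply Rabs_def2 in Ht.
    unfold q'; destruct (Rle_dec 0 0); [|lra].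
    destruct (Rle_dec t 0).
    + rewrite Rminus_diag, Rabs_R0; apply cond_pos.
    + assert (Hdt := Hd' t ltac:(lra)); rewrite Hq0 in Hdt; exact Hdt.
  - apply (continuous_ext_loc q' q r).
    + apply (filter_imp (fun t => 0 < t)); [|apply (open_gt 0), Hr].
      intros t Ht; symmetry; apply Hq'q, Ht.
    + exact (continuous_of_derive _ _ _ (Hd r Hr)). }
set (Q' := fun r => RInt q' 0 r : R).
assert (HQ'd : forall r, is_derive Q' r (q' r)).
{ intros r; apply (is_derive_RInt q' Q' 0 r); [|apply Hc].
  apply filter_forall; intros t; apply (RInt_correct q' 0 t), (ex_RInt_continuous q'); auto. }
assert (HQ'0 : Q' 0 = 0) by exact (RInt_point 0 q').
assert (HQQ : forall r, 0 <= r -> Defs.primitive q r = Q' r).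
{ intros r Hr; apply (RInt_ext (V := R_CompleteNormedModule) q q' 0 r).
  intros x Hx; rewrite Rmin_left in Hx by lra.
  symmetry; apply Hq'q; lra. }
assert (HQd : forall r, 0 < r -> is_derive (Defs.primitive q) r (q r)).
{ intros r Hr; apply (is_derive_ext_loc Q').
  - apply (filter_imp (fun t => 0 < t)); [|apply (open_gt 0), Hr].
    intros t Ht; symmetry; apply HQQ; lra.
  - rewrite <- Hq'q by exact Hr; apply HQ'd. }
split.
- exact Hq.
- exact Hqi.
- intros r Hr; rewrite HQQ by lra; rewrite <- HQ'0.
  apply (incr_of_derive Q' q'); [exact Hr | auto |].
  intros z Hz; rewrite Hq'q by lra; apply Hq; lra.
- exact Hd.
- exact HQd.
- intros r Hr; apply is_derive_unique.
  assert (H1 := Hd r Hr); assert (H2 := HQd r Hr); assert (H3 := Hq r Hr).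
  derive; field; lra.
- exact Hq2.
- exact HKn.
- intros r Hr; apply Rnot_lt_le; intros Hlt.
  apply is_lim_spec in HKinf; simpl in HKinf.
  destruct (HKinf (mkposreal (Hinf - H q r) ltac:(lra))) as [M HM]; simpl in HM.
  assert (Hm1 := Rmax_l r (M + 1)); assert (Hm2 := Rmax_r r (M + 1)).
  specialize (HM (Rmax r (M + 1)) ltac:(lra)); apply Rabs_def2 in HM.
  assert (Hn := HKn r (Rmax r (M + 1)) Hr Hm1); lra.
- intros r Hr; apply Rnot_lt_le; intros Hlt.
  destruct (HK0 (fun z => Rabs (z - H0) < H q r - H0)) as [d Hd'].
  + exists (mkposreal (H q r - H0) ltac:(lra)); intros z Hz; exact Hz.
  + assert (Hdp := cond_pos d).
    assert (Hm : 0 < Rmin (d / 2) r) by (apply Rmin_case; lra).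
    assert (Hm1 := Rmin_l (d / 2) r); assert (Hm2 := Rmin_r (d / 2) r).
    assert (Hb : ball 0 d (Rmin (d / 2) r)) by (apply ball_R, Rabs_def1; lra).
    specialize (Hd' _ Hb Hm); simpl in Hd'; apply Rabs_def2 in Hd'.
    assert (Hn := HKn _ r Hm Hm2); lra.
- exact HHinf.
- exact HH0.
- exact Hex.
- intros e He.
  destruct (continuous_neg_near (fun r => Q' r - e) 0) as [d [Hd0 Hd']].
  + assert (HD := HQ'd 0); eapply continuous_of_derive; derive; reflexivity.
  + lra.
  + exists d; split; [exact Hd0|]; intros r Hr; rewrite HQQ by lra.
    specialize (Hd' r ltac:(apply Rabs_def1; lra)); simpl in Hd'; lra.
Qed.

Lemma Rbar_lt_between (x : R) (c : Rbar) : Rbar_lt x c -> exists y : R, x < y /\ Rbar_lt y c.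
Proof.
destruct c as [c | |]; simpl; intros Hx.
- exists ((x + c) / 2); lra.
- exists (x + 1); split; [lra | exact I].
- destruct Hx.
Qed.

Lemma nonlinearity_of_conditions (c : Rbar) (f : R -> R) (b beta Hinf : R) :
  (forall s, Rbar_lt (Rabs s) c -> continuous f s) ->
  cond_f1 c f b beta -> cond_f2 c f -> cond_f3 c f beta Hinf ->
  nonlinearity c f (Defs.primitive f) (Derive (fun t => Defs.primitive f t / f t)) b beta Hinf.
Proof.
intros Hc [Hodd Hz Hb Hbb Hbc Hpos Hneg Hnt HFb] [Hd Hdc HL] H3.
assert (HF : forall s, 0 <= s -> Rbar_lt s c -> is_derive (Defs.primitive f) s (f s)).
{ intros s Hs Hsc.
  apply (is_derive_RInt f (Defs.primitive f) 0 s); [|apply Hc; rewrite Rabs_pos_eq; assumption].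
  destruct (Rbar_lt_between s c Hsc) as [y [Hy Hyc]].
  apply (filter_imp (fun t => - y < t /\ t < y)).
  - intros t Ht; apply (RInt_correct f 0 t), (ex_RInt_continuous f).
    intros z Hz'; apply Hc, (Rbar_le_lt_trans_R (Rabs z) y); [|exact Hyc].
    apply Rabs_le; revert Hz'; apply Rmin_case; apply Rmax_case; lra.
  - apply filter_and; [apply (open_gt (- y)) | apply (open_lt y)]; lra. }
split.
- exact Hb.
- exact Hbb.
- intros s Hs Hsc; apply Hc; rewrite Rabs_pos_eq; assumption.
- exact HF.
- exact (RInt_point 0 f).
- exact HFb.
- exact Hbc.
- exact Hpos.
- exact Hneg.
- intros s Hs Hsc; apply Derive_correct.
  assert (G1 := HF s ltac:(lra) Hsc).
  assert (G2 := Derive_correct _ _ (Hd s ltac:(lra) Hsc)).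
  assert (G3 := Hpos s Hs Hsc).
  eexists; derive; reflexivity.
- intros s Hs Hsc; specialize (H3 s Hs Hsc); lra.
Qed.

Lemma ground_state_of_solution (c : Rbar) (f q u : R -> R) :
  cond_q1 q -> (forall r, 0 < r -> 0 < q r) ->
  is_solution c f q u -> (forall r, 0 <= r -> 0 <= u r) -> 0 < u 0 ->
  exists du, ground_state c q (Derive q) f u du.
Proof.
intros [[dq [Hdq _]] _ _ _] Hq [Hran [[du [[Hu Huc] [Heq Hdu0]]] Hlim]] Hun Hu0.
exists du.
assert (Hd : forall r, 0 < r -> is_derive q r (Derive q r)).
{ intros r Hr; apply Derive_correct; exists (dq r).
  apply half_derive_interior; [exact Hr | apply Hdq; lra]. }
split.
- intros r Hr; exact (Rbar_le_lt_trans_R _ _ _ (Rle_abs _) (Hran r Hr)).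
- exact Hun.
- exact Hu0.
- intros e He.
  destruct (half_derive_start u _ (Hu 0 (Rle_refl 0)) e He) as [d1 [Hd1 H1]].
  destruct (Huc 0 (Rle_refl 0) (fun z => Rabs (z - du 0) < e)) as [d2 H2].
  { exists (mkposreal e He); intros z Hz; exact Hz. }
  assert (Hd2 := cond_pos d2).
  assert (Hm1 := Rmin_l d1 d2); assert (Hm2 := Rmin_r d1 d2).
  exists (Rmin d1 d2); split; [apply Rmin_case; lra|]; intros r Hr.
  split; [apply H1; lra|].
  rewrite <- (Rminus_0_r (du r)), <- Hdu0; apply H2.
  + apply ball_R, Rabs_def1; lra.
  + unfold Rplus_half; lra.
- intros r Hr; apply half_derive_interior; [exact Hr | apply Hu; lra].
- intros r Hr; destruct (Heq r Hr) as [Hex Hder].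
  assert (G1 := Hd r Hr); assert (G2 := Hq r Hr).
  assert (G3 : is_derive (fun x => q x * du x) r (- (q r * f (u r)))).
  { apply (is_derive_eq _ _ _ _ (Derive_correct _ _ Hex)), Rplus_opp_r_uniq.
    rewrite Rplus_comm; exact Hder. }
  apply (is_derive_ext_loc (fun x => q x * du x / q x)).
  + apply (filter_imp (fun t => 0 < t)); [|apply (open_gt 0), Hr].
    intros t Ht; assert (Hqt := Hq t Ht); change (@eq R (q t * du t / q t) (du t)); field; lra.
  + derive; field; lra.
- intros e He; apply is_lim_spec in Hlim; simpl in Hlim.
  destruct (Hlim (mkposreal e He)) as [M HM]; simpl in HM.
  exists M; intros r Hr; specialize (HM r Hr); apply Rabs_def2 in HM; lra.
Qed.

Theorem theorem1 (c : Rbar) (f : R -> R) (b beta : R) (q : R -> R) (H0 Hinf : R)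
  (hc : Rbar_lt 0 c)
  (hf : forall s, Rbar_lt (Rabs s) c -> continuous f s)
  (hf1 : cond_f1 c f b beta)
  (hf2 : cond_f2 c f)
  (hq1 : cond_q1 q)
  (hq2 : cond_q2 q)
  (hq3 : cond_q3 q H0 Hinf)
  (hf3 : cond_f3 c f beta Hinf) :
  forall u1 u2 : R -> R,
    is_solution c f q u1 -> (forall r, 0 <= r -> 0 <= u1 r) -> 0 < u1 0 ->
    is_solution c f q u2 -> (forall r, 0 <= r -> 0 <= u2 r) -> 0 < u2 0 ->
    forall r, 0 <= r -> u1 r = u2 r.
Proof.
intros u1 u2 Hs1 Hn1 Hp1 Hs2 Hn2 Hp2.
assert (W := weight_of_conditions q H0 Hinf hq1 hq2 hq3).
assert (N := nonlinearity_of_conditions c f b beta Hinf hf hf1 hf2 hf3).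
destruct (ground_state_of_solution c f q u1 hq1 (w_q_pos W) Hs1 Hn1 Hp1) as [du1 G1].
destruct (ground_state_of_solution c f q u2 hq1 (w_q_pos W) Hs2 Hn2 Hp2) as [du2 G2].
exact (ground_state_unique W N
  (fun s Hs Hsc => Derive_correct _ _ (f2_derivable c f hf2 s Hs Hsc))
  (f2_continuous c f hf2) G1 G2).
Qed.
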